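(* Let $X\in\hat{\mathfrak X}(\mathbb C^n,0)$ with $\mathrm{spec}(D_0X)=\{v_1,\dots,v_n\}$ (eigenvalues listed with multiplicity). Then $X$ is an infinitesimal generator of $\mathrm{Exp}(X)$ if and only if $X$ is not weakly resonant.
   Context: A formal vector field $X\in\hat{\mathfrak X}(\mathbb C^n,0)$ with $\mathrm{spec}(D_0X)=\{v_1,\dots,v_n\}$ (eigenvalues listed with multiplicity) is called not weakly resonant if there is no $(m_1,\dots,m_n)\in\mathbb Z^n$ such that $\sum_{j=1}^n m_jv_j\in2\pi i\,\mathbb Q^*$, where $\mathbb Q^*=\mathbb Q\setminus\{0\}$. Let $\hat{\mathcal O}_n=\mathbb C[[x_1,\dots,x_n]]$ with maximal ideal $\mathfrak m$. $\widehat{\mathrm{Diff}}(\mathbb C^n,0)$ is the group (under composition) of formal diffeomorphisms, i.e. $n$-tuples $F\in\mathfrak m^n$ with invertible linear part $D_0F$. $\hat{\mathfrak X}(\mathbb C^n,0)$ is the Lie algebra of singular formal vector fields $X=\sum a_j\,\partial/\partial x_j$, $a_j\in\mathfrak m$, and $D_0X$ is the linear part of $X$. $\mathrm{Exp}(tX)$ is the formal diffeomorphism determined by $g\circ\mathrm{Exp}(tX)=\sum_{j\ge0}t^jX^j(g)/j!$ for $g\in\hat{\mathcal O}_n$. For $k\ge1$, let $\pi_k(F)\in GL(\mathfrak m/\mathfrak m^{k+1})$ be the map $f+\mathfrak m^{k+1}\mapsto f\circ F+\mathfrak m^{k+1}$ and $D_k=\pi_k(\widehat{\mathrm{Diff}}(\mathbb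 C^n,0))$, an algebraic matrix group (the group of $k$-jets); let $d\pi_k(X)$ be the derivation of $\mathfrak m/\mathfrak m^{k+1}$ induced by $X$, an element of the Lie algebra of $D_k$. For a subgroup $G$ of $\widehat{\mathrm{Diff}}(\mathbb C^n,0)$, let $G_k$ be the Zariski closure of $\pi_k(G)$ and $\mathfrak g_k$ its Lie algebra. The Zariski (pro-algebraic) closure of $G$ is $\overline G=\{F:\pi_k(F)\in G_k\ \forall k\ge1\}$ and its Lie algebra is $\mathfrak g=\{X\in\hat{\mathfrak X}(\mathbb C^n,0):d\pi_k(X)\in\mathfrak g_k\ \forall k\ge1\}$. $X$ is an infinitesimal generator of $F\in\widehat{\mathrm{Diff}}(\mathbb C^n,0)$ if $F=\mathrm{Exp}(X)$ and $X$ belongs to the Lie algebra of $\overline{\langle F\rangle}$, where $\langle F\rangle$ is the group generated by $F$. *)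

(* Defs.v *)
(* Multi-indices and polynomials in the entries of a matrix come from
   multinomials, whose notations clash with those of MathComp-Analysis and are
   not imported: multinom n is the type 'X_{1..n} of multi-indices, mdeg m is
   |m|, mnm0 is the zero multi-index, mnm1 i is U_(i), bmultinom n b is the
   finite type of the multi-indices of degree < b, meval is evaluation and
   mderiv is partial derivation. *)
From HB Require Import structures.
From mathcomp Require Import all_boot all_order all_algebra.
From mathcomp Require Import complex.
From mathcomp Require Import -(notations) mpoly.
From mathcomp Require Import boolp classical_sets functions reals topology.
From mathcomp Require Import normedtype sequences trigo.

Set Implicit Arguments.
Unset Strict Implicit.
Unset Printing Implicit Defensive.

Import Order.TTheory GRing.Theory Num.Theory numFieldNormedType.Exports.
Local Open Scope classical_set_scope.
Local Open Scope ring_scope.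

(* Giving R[i] the type numClosedFieldType makes its topology available. *)
Definition Cplx (R : realType) : numClosedFieldType := R[i].

(* K[[x_1, ..., x_n]]: f m is the coefficient of x^m in f. *)
Definition fps (n : nat) (K : comNzRingType) : Type := multinom n -> K.

HB.instance Definition _ (n : nat) (K : comNzRingType) :=
  GRing.Zmodule.on (fps n K).

Section PowerSeriesRing.
Variables (n : nat) (K : comNzRingType).
Implicit Types f g h : fps n K.

Definition fps_one : fps n K := fun m => (m == mnm0)%:R.

Definition fps_mul f g : fps n K := fun m =>
  \sum_(k : bmultinom n (mdeg m).+1 * bmultinom n (mdeg m).+1
        | m == mnm_add k.1 k.2) f k.1 * g k.2.

Let trunc (d : nat) f : mpoly n K :=
  \sum_(m : bmultinom n d) f m *: mpolyX K m.

Let mcoeff_trunc d f (m : multinom n) :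
  (mdeg m < d)%N -> mcoeff m (trunc d f) = f m.
Proof.
move=> lt_md; rewrite /trunc raddf_sum /=.
rewrite (bigD1 (BMultinom lt_md)) //= mcoeffZ mcoeffX eqxx mulr1.
rewrite big1 ?addr0 // => i ne_im; rewrite mcoeffZ mcoeffX.
by move: ne_im; rewrite bmeqP /= => /negbTE ->; rewrite mulr0.
Qed.

Let fps_mulE d f g m : (mdeg m < d)%N ->
  fps_mul f g m = mcoeff m (trunc d f * trunc d g).
Proof.
move=> lt_md; rewrite mcoeffM; apply: eq_bigr => k _.
by rewrite !mcoeff_trunc //; exact: leq_trans (bmdeg _) lt_md.
Qed.

Let fps_mulA : associative fps_mul.
Proof.
move=> f g h; apply/funext => m; set d := (mdeg m).+1.
transitivity (mcoeff m (trunc d f * (trunc d g * trunc d h))).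
  rewrite mcoeffM; apply: eq_bigr => k _.
  by rewrite mcoeff_trunc ?bmdeg // -fps_mulE ?bmdeg.
rewrite mulrA mcoeffM; apply: eq_bigr => k _.
by rewrite [in RHS]/= (@mcoeff_trunc d h) ?bmdeg // -fps_mulE ?bmdeg.
Qed.

Let fps_mulC : commutative fps_mul.
Proof.
by move=> f g; apply/funext => m; rewrite !(@fps_mulE (mdeg m).+1) // mulrC.
Qed.

Let fps_mul1 : left_id fps_one fps_mul.
Proof.
move=> f; apply/funext => m; rewrite (@fps_mulE (mdeg m).+1) //.
have -> : trunc (mdeg m).+1 fps_one = 1.
  apply/mpolyP => p; rewrite mcoeff1.
  rewrite /trunc raddf_sum /= (bigD1 (@bm0 _ _)) //=.
  rewrite mcoeffZ mcoeffX /fps_one eqxx mul1r big1 => [|i ne_i0].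
    by rewrite addr0 eq_sym.
  by move: ne_i0; rewrite bmeqP /= mcoeffZ => /negbTE ->; rewrite mul0r.
by rewrite mul1r mcoeff_trunc.
Qed.

Let fps_mulDl : left_distributive fps_mul +%R.
Proof.
move=> f g h; apply/funext => m; rewrite /fps_mul.
transitivity (\sum_(k : bmultinom n (mdeg m).+1 * bmultinom n (mdeg m).+1
    | m == mnm_add k.1 k.2) (f k.1 * h k.2 + g k.1 * h k.2)).
  by apply: eq_bigr => k _; rewrite -mulrDl.
by rewrite big_split.
Qed.

Let fps_one_neq0 : fps_one != 0.
Proof.
apply/eqP => /(congr1 (fun f : fps n K => f mnm0)) /eqP.
by rewrite /fps_one eqxx oner_eq0.
Qed.

HB.instance Definition _ := GRing.Zmodule_isComNzRing.Build (fps n K)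
  fps_mulA fps_mulC fps_mul1 fps_mulDl fps_one_neq0.

End PowerSeriesRing.

(* m / m^(k+1) is identified with row vectors, through the basis of the
   monomials x^m with 1 <= |m| <= k. *)
Definition jet_monom (n k : nat) : pred (bmultinom n k.+1) :=
  fun m => (0 < mdeg m)%N.
Arguments jet_monom : clear implicits.

Definition jet_exponent (n k : nat) (i : 'I_#|jet_monom n k|) : multinom n :=
  bmnm (enum_val i).

Section Jets.
Variables (n : nat) (K : fieldType).
Implicit Types (f g : fps n K) (F G X : 'I_n -> fps n K).

Definition max_ideal : set (fps n K) := [set f | f mnm0 = 0].

Definition fps_var (i : 'I_n) : fps n K := fun m => (m == mnm1 i)%:R.

Definition fps_deriv (i : 'I_n) f : fps n K :=
  fun m => f (mnm_add m (mnm1 i)) *+ (m i).+1.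

(* f \o F, for F a tuple of elements of the maximal ideal: then F^b has order
   at least |b|, and only the b of degree at most |m| contribute to the
   coefficient of x^m. *)
Definition fps_comp f F : fps n K := fun m =>
  \sum_(b : bmultinom n (mdeg m).+1) f b * (\prod_(i < n) F i ^+ b i) m.

(* Formal vector fields \sum_i X_i d/dx_i and formal maps are both given by the
   n-tuple of their components. *)
Definition linear_part F : 'M[K]_n := \matrix_(i, j) F i (mnm1 j).

Definition singular_vf : set ('I_n -> fps n K) :=
  [set X | forall i, max_ideal (X i)].

Definition vf_act X f : fps n K := \sum_(i < n) X i * fps_deriv i f.

Definition formal_diff : set ('I_n -> fps n K) :=
  [set F | (forall i, max_ideal (F i)) /\ linear_part F \in unitmx].

Definition map_comp F G : 'I_n -> fps n K := fun i => fps_comp (F i) G.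

Definition diff_subgroup (H : set ('I_n -> fps n K)) : Prop :=
  [/\ H `<=` formal_diff,
      H fps_var,
      (forall F G, H F -> H G -> H (map_comp F G)) &
      forall F, H F ->
        exists2 G, H G & map_comp F G = fps_var /\ map_comp G F = fps_var].

(* <F> *)
Definition cyclic_diff F : set ('I_n -> fps n K) :=
  smallest diff_subgroup [set F].

Definition jet (k : nat) f : 'rV[K]_#|jet_monom n k| := \row_i f (jet_exponent i).

Definition jet_lift (k : nat) (u : 'rV[K]_#|jet_monom n k|) : fps n K :=
  fun m => \sum_i u 0 i * (m == jet_exponent i)%:R.

(* pi_k F, the matrix of f + m^(k+1) |-> f \o F + m^(k+1) *)
Definition jet_mx (k : nat) F : 'M[K]_#|jet_monom n k| :=
  lin1_mx (fun u => jet k (fps_comp (jet_lift u) F)).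

(* d pi_k X, the matrix of f + m^(k+1) |-> X(f) + m^(k+1) *)
Definition jet_vf_mx (k : nat) X : 'M[K]_#|jet_monom n k| :=
  lin1_mx (fun u => jet k (vf_act X (jet_lift u))).

Let jet_lift_delta k (i : 'I_#|jet_monom n k|) :
  jet_lift (delta_mx 0 i) = fun m => (m == jet_exponent i)%:R.
Proof.
apply/funext => m; rewrite /jet_lift (bigD1 i) //= mxE !eqxx mul1r.
by rewrite big1 ?addr0 // => j /negbTE ne_ji; rewrite mxE ne_ji andbF mul0r.
Qed.

Let jet_liftK k f m : max_ideal f -> (mdeg m <= k)%N ->
  jet_lift (jet k f) m = f m.
Proof.
rewrite /max_ideal /= => f0 le_mk; rewrite /jet_lift.
have lt_mk : (mdeg m < k.+1)%N by [].
case: (posnP (mdeg m)) => [/eqP|gt0m].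
  rewrite mdeg_eq0 => /eqP -> {m le_mk lt_mk}; rewrite f0 big1 // => i _.
  case: eqP => [m0|]; last by rewrite mulr0.
  by have := enum_valP i; rewrite unfold_in /jet_monom -[bmnm _]m0 mdeg0.
have m_in : BMultinom lt_mk \in jet_monom n k by [].
rewrite (bigD1 (enum_rank_in m_in (BMultinom lt_mk))) //=.
rewrite mxE /jet_exponent enum_rankK_in //= eqxx mulr1 big1 ?addr0 // => i ne_i.
case: eqP => [m_i|]; last by rewrite mulr0.
case/eqP: ne_i; apply: enum_val_inj; rewrite enum_rankK_in //.
by apply: val_inj; rewrite /= m_i.
Qed.

Lemma jet_mxE k f F : max_ideal f ->
  jet k f *m jet_mx k F = jet k (fps_comp f F).
Proof.
move=> f0; apply/rowP => j; rewrite !mxE.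
pose c (b : multinom n) := (\prod_(i < n) F i ^+ b i) (jet_exponent j).
transitivity (\sum_(b : bmultinom n (mdeg (jet_exponent j)).+1)
    jet_lift (jet k f) b * c b); last first.
  apply: eq_bigr => b _; rewrite jet_liftK // -ltnS.
  exact: leq_trans (bmdeg b) (bmdeg _).
rewrite /jet_lift; under [RHS]eq_bigr do rewrite mulr_suml.
rewrite exchange_big /=; apply: eq_bigr => i _.
rewrite !mxE jet_lift_delta mulr_sumr; apply: eq_bigr => b _.
by rewrite mulrA.
Qed.

Lemma jet_vf_mxE k f X : singular_vf X -> max_ideal f ->
  jet k f *m jet_vf_mx k X = jet k (vf_act X f).
Proof.
move=> X0 f0; apply/rowP => j; rewrite !mxE.
set d := enum_val j.
have vf_actE g : vf_act X g d = \sum_(i < n)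
    \sum_(p : bmultinom n (mdeg d).+1 * bmultinom n (mdeg d).+1
          | bmnm d == mnm_add p.1 p.2)
      X i p.1 * (g (mnm_add p.2 (mnm1 i)) *+ (p.2 i).+1).
  by rewrite /vf_act; elim/big_ind2: _ => // ? ? ? ? <- <-.
rewrite vf_actE.
transitivity (\sum_(i < n)
    \sum_(p : bmultinom n (mdeg d).+1 * bmultinom n (mdeg d).+1
          | bmnm d == mnm_add p.1 p.2)
      X i p.1 * (jet_lift (jet k f) (mnm_add p.2 (mnm1 i)) *+ (p.2 i).+1)).
  under [RHS]eq_bigr => i _ do
    under eq_bigr => p _ do rewrite /jet_lift -sumrMnl mulr_sumr.
  under [RHS]eq_bigr => i _ do rewrite exchange_big /=.
  rewrite exchange_big /=; apply: eq_bigr => l _.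
  rewrite !mxE vf_actE mulr_sumr; apply: eq_bigr => i _.
  rewrite mulr_sumr; apply: eq_bigr => p _.
  by rewrite jet_lift_delta -mulrnAr mulrCA.
apply: eq_bigr => i _; apply: eq_bigr => p /eqP dE.
have [p0|gt0p] := posnP (mdeg p.1).
  have -> : bmnm p.1 = mnm0 by apply/eqP; rewrite -mdeg_eq0 p0.
  by rewrite X0 !mul0r.
rewrite jet_liftK // mdegD mdeg1 addn1 -ltnS.
apply: leq_trans (bmdeg d); rewrite ltnS.
have dd : mdeg d = (mdeg p.1 + mdeg p.2)%N by rewrite -mdegD -dE.
apply: (@leq_trans (mdeg p.1 + mdeg p.2)); last by rewrite -dd.
by rewrite -add1n leq_add2r.
Qed.

End Jets.

Arguments jet {n K} k f.
Arguments jet_mx {n K} k F.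
Arguments jet_vf_mx {n K} k X.

Section AlgebraicGroups.
Variables (N : nat) (K : fieldType).

Definition mx_eval (p : mpoly (N * N) K) (A : 'M[K]_N) : K :=
  meval (fun i => mxvec A 0 i) p.

Definition vanishes_on (S : set 'M[K]_N) (p : mpoly (N * N) K) : Prop :=
  forall A, S A -> mx_eval p A = 0.

(* Zariski closure in GL_N; the regular functions on GL_N are of the form
   p / det^r, and such a function vanishes where p does. *)
Definition zariski_closure (S : set 'M[K]_N) : set 'M[K]_N :=
  [set A | A \in unitmx /\ forall p, vanishes_on S p -> mx_eval p A = 0].

(* Lie algebra of an algebraic subgroup of GL_N: its tangent space at 1. *)
Definition lie_algebra (H : set 'M[K]_N) : set 'M[K]_N :=
  [set B | forall p, vanishes_on H p ->
     \sum_(i < N * N) mx_eval (mderiv i p) 1%:M * mxvec B 0 i = 0].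

End AlgebraicGroups.

Section ProAlgebraicGroups.
Variables (n : nat) (K : fieldType) (G : set ('I_n -> fps n K)).

(* G_k *)
Definition jet_closure (k : nat) : set 'M[K]_#|jet_monom n k| :=
  zariski_closure (jet_mx k @` G).
Arguments jet_closure : clear implicits.

Definition pro_closure : set ('I_n -> fps n K) :=
  [set F | formal_diff F /\
     forall k, (1 <= k)%N -> jet_closure k (jet_mx k F)].

(* The Lie algebra of pro_closure, which is defined from the groups G_k. *)
Definition lie_pro_closure : set ('I_n -> fps n K) :=
  [set X | singular_vf X /\
     forall k, (1 <= k)%N -> lie_algebra (jet_closure k) (jet_vf_mx k X)].

End ProAlgebraicGroups.

Section InfinitesimalGenerator.
Variables (R : realType) (n : nat).
Implicit Types (F X : 'I_n -> fps n (Cplx R)).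

(* The characterization of F = Exp X, where the series of formal power series
   converges coefficientwise. *)
Definition is_exp X F : Prop :=
  formal_diff F /\
  forall (g : fps n (Cplx R)) (m : multinom n),
    [series iter j (vf_act X) g m / j`!%:R]_j @ \oo --> fps_comp g F m.

(* The F such that is_exp X F, which exists and is unique when X is singular *)
Definition Exp X : 'I_n -> fps n (Cplx R) :=
  xget (@fps_var n (Cplx R)) (is_exp X).

Definition infinitesimal_generator X F : Prop :=
  F = Exp X /\ lie_pro_closure (cyclic_diff F) X.

(* spec A = {v_1, ..., v_n}, with multiplicities *)
Definition has_spectrum (A : 'M[Cplx R]_n) (v : 'I_n -> Cplx R) : Prop :=
  char_poly A = \prod_(i < n) ('X - (v i)%:P).

Definition two_pi_i : Cplx R := 2 * (pi : R)%:C%C * 'i.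

Definition not_weakly_resonant (v : 'I_n -> Cplx R) : Prop :=
  ~ exists (m : 'I_n -> int) (q : rat),
      q != 0 /\ \sum_(j < n) v j *~ m j = two_pi_i * ratr q.

End InfinitesimalGenerator.

(* Main.v *)
(* Let B be the derivation induced by X on k-jets.  Along the flow Exp(tX), a
   polynomial p in the entries of the jet matrix exp(tB) is an exponential
   polynomial f(t) = sum_l a_l t^l / l!, whose exponents are integer
   combinations of v_1, ..., v_n; moreover a_1 = f'(0) is the derivative of p
   at 1 in the direction B.  If v is not weakly resonant, then exp is injective
   on these exponents, and an exponential polynomial vanishing at all natural
   numbers is zero; so p vanishing on the powers of exp(B) forces a_1 = 0, which
   says that B lies in the Lie algebra of the Zariski closure.  Conversely,
   clearing denominators in a weak resonance gives sum_j m_j v_j = 2 pi i z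
   with z a nonzero integer.  In a basis where the linear part is triangular,
   the function prod_j g_jj^m_j is 1 on the powers of exp(B), while its
   derivative at 1 in the direction B is 2 pi i z.

   Exponential polynomials are handled through the sequences (a_l), on which
   d/dt acts as the shift and the product as the binomial convolution. *)
Require Import Defs.
From HB Require Import structures.
From mathcomp Require Import all_boot all_order all_algebra.
From mathcomp Require Import perm complex ring lra.
From mathcomp Require Import -(notations) mpoly.
From mathcomp Require Import boolp classical_sets functions reals topology.
From mathcomp Require Import normedtype sequences exp trigo.

Set Implicit Arguments.
Unset Strict Implicit.
Unset Printing Implicit Defensive.

Import Order.TTheory GRing.Theory Num.Theory numFieldNormedType.Exports.
Import Normc.
Local Open Scope classical_set_scope.
Local Open Scope ring_scope.

(** * Exponential generating functions *)

Section ExponentialSum.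
Variable R : realType.
Local Notation C := (Cplx R).
Implicit Types (a b : nat -> C) (x y : C).

(** The analysis is carried out on the scalar sequences of coefficients of X^l(f), with no norm on
    jets or matrices. That such a sequence has finitely many exponents is pure algebra, and this
    already gives the geometric growth under which its generating function converges everywhere. The
    two identities that would need an exchange of infinite sums, the product formula and Taylor's
    formula for f(t + s), are checked on the monomials t^n / n! and extended by continuity.

    The obstacle is that zeros at all natural numbers do not determine an exponential polynomial:
    e^(2 pi i t) - 1 is a counterexample. Two exponents with the same exponential differ by 2 pi i z
    with z an integer; as both are integer combinations of the v_j, this is a weak resonance unless
    z = 0. In the converse the exponents m_j may be negative, so that the character is not a
    polynomial: it is replaced by the difference of two monomials in the diagonal entries. *)

Lemma normc_ge0 x : 0 <= normc x.
Proof. by case: x => u w /=; rewrite sqrtr_ge0. Qed.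

Lemma normcE x : `|x| = (normc x)%:C%C. Proof. by []. Qed.

Lemma normcX x k : normc (x ^+ k) = normc x ^+ k.
Proof.
elim: k => [|k IH]; first by rewrite !expr0 normc1.
by rewrite !exprS normcM IH.
Qed.

Lemma normc_Re x : `|complex.Re x| <= normc x.
Proof.
case: x => u w /=; rewrite -sqrtr_sqr ler_sqrt ?lerDl ?sqr_ge0 //.
by rewrite addr_ge0 ?sqr_ge0.
Qed.

Lemma normc_Im x : `|complex.Im x| <= normc x.
Proof.
case: x => u w /=; rewrite -sqrtr_sqr ler_sqrt ?lerDr ?sqr_ge0 //.
by rewrite addr_ge0 ?sqr_ge0.
Qed.

Lemma normc_ReIm x : normc x <= `|complex.Re x| + `|complex.Im x|.
Proof.
case: x => u w /=; rewrite -[leRHS]ger0_norm ?addr_ge0 // -sqrtr_sqr.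
rewrite ler_sqrt ?sqr_ge0 //.
rewrite -(real_normK (num_real u)) -(real_normK (num_real w)) sqrrD.
by rewrite lerD2r lerDl mulrn_wge0 // mulr_ge0.
Qed.

Lemma cvg_Cplx (u : nat -> C) x :
  (fun k => complex.Re (u k)) @ \oo --> complex.Re x ->
  (fun k => complex.Im (u k)) @ \oo --> complex.Im x ->
  u @ \oo --> x.
Proof.
move=> cr ci; apply/cvgrPdist_lt => e; rewrite ltcE /= => /andP[/eqP ei er].
(* A positive element for the order on C is real. *)
have ->: e = (complex.Re e)%:C%C by case: e ei er => ? ? /= ->.
have er2 : 0 < complex.Re e / 2 by rewrite divr_gt0.
move/cvgrPdist_lt: cr => /(_ _ er2) cr.
move/cvgrPdist_lt: ci => /(_ _ er2) ci.
near=> k; rewrite normcE ltcR.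
apply: le_lt_trans (normc_ReIm _) _; rewrite [complex.Re e]splitr.
have hr : `|complex.Re x - complex.Re (u k)| < complex.Re e / 2 by near: k.
have hi : `|complex.Im x - complex.Im (u k)| < complex.Re e / 2 by near: k.
move: hr hi; case: (x) (u k) => ? ? [? ?] /=; exact: ltrD.
Unshelve. all: by end_near. Qed.

Lemma ReD x y : complex.Re (x + y) = complex.Re x + complex.Re y.
Proof. by case: x y => ? ? []. Qed.
Lemma ImD x y : complex.Im (x + y) = complex.Im x + complex.Im y.
Proof. by case: x y => ? ? []. Qed.

Lemma ReMr x (r : R) : complex.Re (x * r%:C%C) = complex.Re x * r.
Proof. by case: x => ? ? /=; rewrite mulr0 subr0. Qed.
Lemma ImMr x (r : R) : complex.Im (x * r%:C%C) = complex.Im x * r.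
Proof. by case: x => ? ? /=; rewrite mulr0 add0r. Qed.

Lemma factCE k : (k`!%:R : C)^-1 = ((k`!%:R)^-1 : R)%:C%C.
Proof. by rewrite [RHS]fmorphV rmorph_nat. Qed.

(** Geometric growth of a means that sum_l a_l t^l / l! is entire of exponential type, a class
    stable under sums, products, derivation and translation. The constants carry no sign condition;
    [geom_bounded_norm] makes them nonnegative. *)
Definition geom_bounded a (c r : R) := forall l, normc (a l) <= c * r ^+ l.
Definition subgeom a := exists c r : R, geom_bounded a c r.

Definition egf1_Re a : nat -> R := fun l => complex.Re (a l) / l`!%:R.
Definition egf1_Im a : nat -> R := fun l => complex.Im (a l) / l`!%:R.

(** Real and imaginary parts are summed separately, so that comparison of real series applies to
    each. *)
Definition egf1 a : C := Complex (limn (series (egf1_Re a))) (limn (series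
  (egf1_Im a))).

Lemma geom_bounded_norm a c r : geom_bounded a c r -> geom_bounded a `|c| `|r|.
Proof.
move=> h l; apply: (le_trans (h l)); rewrite -normrX -normrM; exact: ler_norm.
Qed.

(** Domination by |c| times the exponential series at |r|. The bound on the limit is kept because
    [density] asks for functionals that are bounded uniformly at a given rate. *)
Lemma bounded_exp_series (u : nat -> R) c r : (forall l,
  `|u l| <= c * r ^+ l) ->
  cvgn (series (fun l => u l / l`!%:R)) /\
  `|limn (series (fun l => u l / l`!%:R))| <= `|c| * expR `|r|.
Proof.
move=> h; pose v l : R := `|c| * (exp_coeff `|r| l).
have cv : cvgn (series v).
  exact: (is_cvg_seriesZ (k := `|c|) (is_cvg_series_exp_coeff _)).
have uv l : `|u l / l`!%:R| <= v l.
  rewrite normrM normfV normr_nat /v /exp_coeff /= mulrA.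
  apply: ler_wpM2r; first by rewrite invr_ge0 ler0n.
  apply: (le_trans (h l)); rewrite -normrX -normrM; exact: ler_norm.
have cn : cvgn [normed series (fun l => u l / l`!%:R)].
  by apply: (series_le_cvg _ _ uv cv) => l //; apply: le_trans (uv l).
have cu := normed_cvg cn; split=> //.
apply: le_trans (lim_series_norm cn) _.
have -> : `|c| * expR `|r| = limn (series v).
  by rewrite (lim_seriesZ `|c| (is_cvg_series_exp_coeff _)).
exact: lim_series_le.
Qed.

Lemma cvg_egf1_Re a : subgeom a -> cvgn (series (egf1_Re a)).
Proof.
move=> [c [r h]]; apply: (bounded_exp_series (c := c) (r := r) _).1 => l.
exact: le_trans (normc_Re _) (h l).
Qed.

Lemma cvg_egf1_Im a : subgeom a -> cvgn (series (egf1_Im a)).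
Proof.
move=> [c [r h]]; apply: (bounded_exp_series (c := c) (r := r) _).1 => l.
exact: le_trans (normc_Im _) (h l).
Qed.

Lemma egf1P a : subgeom a -> [series a l / l`!%:R]_l @ \oo --> egf1 a.
Proof.
move=> ba; apply: cvg_Cplx.
- rewrite (_ : (fun k => _) = series (egf1_Re a)); first exact: cvg_egf1_Re.
  apply/funext => k; rewrite /series /=.
  elim/big_ind2: _ => // [? ? ? ? <- <-|l _]; first by rewrite -ReD.
  by rewrite factCE ReMr.
- rewrite (_ : (fun k => _) = series (egf1_Im a)); first exact: cvg_egf1_Im.
  apply/funext => k; rewrite /series /=.
  elim/big_ind2: _ => // [? ? ? ? <- <-|l _]; first by rewrite -ImD.
  by rewrite factCE ImMr.
Qed.

Lemma egf1_le a c r : geom_bounded a c r ->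
  normc (egf1 a) <= 2 * (`|c| * expR `|r|).
Proof.
move=> h; apply: le_trans (normc_ReIm _) _;
  rewrite mulr2n mulrDl mul1r lerD //=.
  apply: (bounded_exp_series _).2 => l; exact: le_trans (normc_Re _) (h l).
apply: (bounded_exp_series _).2 => l; exact: le_trans (normc_Im _) (h l).
Qed.

Lemma geom_bounded_comb a b x c r c' r' :
  geom_bounded a c r -> geom_bounded b c' r' ->
  geom_bounded (fun l => a l + x * b l) (`|c| + normc x * `|c'|) (`|r| + `|r'|).
Proof.
move=> /geom_bounded_norm h /geom_bounded_norm h' l.
apply: le_trans (le_normcD _ _) _; rewrite normcM mulrDl; apply: lerD.
  apply: le_trans (h l) _; apply: ler_wpM2l => //.
  by apply: lerXn2r; rewrite ?nnegrE ?addr_ge0 // lerDl.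
rewrite -mulrA; apply: ler_wpM2l; first exact: normc_ge0.
apply: le_trans (h' l) _; apply: ler_wpM2l => //.
by apply: lerXn2r; rewrite ?nnegrE ?addr_ge0 // lerDr.
Qed.

Lemma subgeom_comb a b x : subgeom a -> subgeom b -> subgeom (fun l =>
  a l + x * b l).
Proof.
move=> [c [r h]] [c' [r' h']]; do 2 eexists; exact: geom_bounded_comb h h'.
Qed.

Lemma ReM x y : complex.Re (x * y) =
  complex.Re x * complex.Re y - complex.Im x * complex.Im y.
Proof. by case: x y => ? ? []. Qed.
Lemma ImM x y : complex.Im (x * y) =
  complex.Re x * complex.Im y + complex.Im x * complex.Re y.
Proof. by case: x y => ? ? [] ? ? /=. Qed.

Lemma Cplx_ext x y : complex.Re x = complex.Re y ->
  complex.Im x = complex.Im y -> x = y.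
Proof. by case: x y => ? ? [? ?] /= -> ->. Qed.

(** The real part of a + x b involves three real series, those of Re a, Re b and Im b; the imaginary
    part likewise. *)
Lemma lim_series_comb3 (u v w : nat -> R) (p q : R) :
  cvgn (series u) -> cvgn (series v) -> cvgn (series w) ->
  limn (series (fun l => u l + p * v l + q * w l)) =
  limn (series u) + p * limn (series v) + q * limn (series w).
Proof.
move=> cu cv cw.
have cz (k : R) (h : nat -> R) :
  cvgn (series h) -> cvgn (series (fun l => k * h l)) by exact: is_cvg_seriesZ.
have lz (k : R) (h : nat -> R) :
  cvgn (series h) -> k * limn (series h) = limn (series (fun l => k * h l)).
  by move=> ch; rewrite (lim_seriesZ k ch).
have cpv := cz p v cv; have cqw := cz q w cw.
by rewrite !lz // -lim_seriesD // -lim_seriesD //; exact: is_cvg_seriesD.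
Qed.

Lemma egf1_comb a b x : subgeom a -> subgeom b ->
  egf1 (fun l => a l + x * b l) = egf1 a + x * egf1 b.
Proof.
move=> ba bb; apply: Cplx_ext.
- rewrite ReD ReM /= -mulNr addrA -lim_series_comb3; last 3 first.
  + exact: cvg_egf1_Re.
  + exact: cvg_egf1_Re.
  + exact: cvg_egf1_Im.
  congr (limn (series _)); apply/funext => l; rewrite /egf1_Re /egf1_Im ReD ReM.
  by rewrite !mulrDl !mulNr !mulrA -addrA.
- rewrite ImD ImM /= addrA -lim_series_comb3; last 3 first.
  + exact: cvg_egf1_Im.
  + exact: cvg_egf1_Im.
  + exact: cvg_egf1_Re.
  congr (limn (series _)); apply/funext => l; rewrite /egf1_Re /egf1_Im ImD ImM.
  by rewrite !mulrDl !mulrA -addrA.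
Qed.

End ExponentialSum.

(** * Products and translations of generating functions *)

Section OneParameter.
Variable R : realType.
Local Notation C := (Cplx R).
Implicit Types (a b : nat -> C) (x y s t : C).

(** The sequence of the monomial t^n / n!. *)
Definition delta_seq (n : nat) : nat -> C := fun l => (l == n)%:R.

Lemma subgeom_fin a N : (forall l, (N <= l)%N -> a l = 0) -> subgeom a.
Proof.
move=> h; exists (\sum_(l < N) normc (a l)), 1 => l; rewrite expr1n mulr1.
have ge0 P : 0 <= \sum_(i < N | P i) normc (a i).
  by apply: sumr_ge0 => i _; exact: normc_ge0.
have [/h ->|lN] := leqP N l; first by rewrite normc0.
by rewrite (bigD1 (Ordinal lN)) //= lerDl.
Qed.

Lemma egf1_fin a N : (forall l, (N <= l)%N -> a l = 0) ->
  egf1 a = \sum_(l < N) a l / l`!%:R.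
Proof.
move=> h; apply: (cvg_unique _ (egf1P (subgeom_fin h))) => //=.
apply: (@cvg_near_cst nat C); exists N => // k /= Nk.
rewrite -(subnKC Nk) /series /= big_mkord big_split_ord /=.
by rewrite [X in _ + X]big1 ?addr0 // => i _; rewrite h ?mul0r // leq_addr.
Qed.

Lemma subgeom_delta n : subgeom (delta_seq n).
Proof.
by apply: (@subgeom_fin _ n.+1) => l; rewrite /delta_seq; case: eqP => // ->;
  rewrite ltnn.
Qed.

Lemma subgeom0 : subgeom (fun=> 0 : C).
Proof. exact: (@subgeom_fin _ 0). Qed.

(* An identity of functionals of a sequence need only be checked on finitely
   supported sequences. *)
Lemma density (D : (nat -> C) -> C) :
  (forall a b x, subgeom a -> subgeom b ->
     D (fun l => a l + x * b l) = D a + x * D b) ->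
  (forall r, exists K : R, forall a c, geom_bounded a c r ->
     normc (D a) <= `|c| * K) ->
  (forall n, D (delta_seq n) = 0) ->
  forall a, subgeom a -> D a = 0.
Proof.
move=> Dlin Dbnd Ddelta a ba.
have D0 : D (fun=> 0) = 0.
  have := Dlin (delta_seq 0) (delta_seq 0) (-1) (subgeom_delta 0)
    (subgeom_delta 0).
  rewrite Ddelta mulr0 addr0 => e; rewrite -[RHS]e; congr D; apply/funext => l.
  by rewrite mulN1r subrr.
pose tr N : nat -> C := fun l => if (l < N)%N then a l else 0.
have trS N : tr N.+1 = fun l => tr N l + a N * delta_seq N l.
  apply/funext => l; rewrite /tr /delta_seq ltnS leq_eqVlt.
  by case: eqP => [->|_] /=; rewrite ?ltnn ?add0r ?mulr1 // mulr0 addr0.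
have btr N : subgeom (tr N).
  by apply: (@subgeom_fin _ N) => l; rewrite /tr leqNgt => /negbTE ->.
have Dtr N : D (tr N) = 0.
  elim: N => [|N IH]; first by rewrite -[RHS]D0; congr D; exact/funext.
  by rewrite trS Dlin ?IH ?Ddelta ?mulr0 ?addr0 //; exact: subgeom_delta.
case: (ba) => c [r /geom_bounded_norm h].
(* At twice the rate, the tail of a beyond N is bounded with the constant |c| / 2^N, which makes D a
   arbitrarily small. *)
have [K hK] := Dbnd (2 * `|r|).
have key N : normc (D a) * 2 ^+ N <= `|c| * `|K|.
  have -> : D a = D (fun l => a l + (-1) * tr N l).
    by rewrite Dlin // Dtr mulr0 addr0.
  rewrite -ler_pdivlMr ?exprn_gt0 // mulrAC.
  apply: (@le_trans _ _ (`| (`|c| / 2 ^+ N) | * K)).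
    apply: hK => l; rewrite mulN1r /tr; case: ltnP => [lN|Nl].
      by rewrite subrr normc0 !mulr_ge0 ?invr_ge0 ?exprn_ge0 // mulr_ge0.
    rewrite subr0; apply: le_trans (h l) _; rewrite -mulrA ler_wpM2l //.
    rewrite exprMn mulrA ler_peMl ?exprn_ge0 // ler_pdivlMl ?exprn_gt0 //.
    by rewrite mulr1 ler_weXn2l // ler1n.
  rewrite ger0_norm ?divr_ge0 ?exprn_ge0 // ler_wpM2l ?ler_norm //.
  by rewrite divr_ge0 ?exprn_ge0.
apply/eqP; case: eqP => // /eqP Da.
have Dpos : 0 < normc (D a).
  by rewrite lt_def normc_ge0 andbT; apply: contra Da => /eqP /eq0_normc ->.
(* With M above the quotient, [key M] would give 2^M < M. *)
pose M := Num.bound (`|c| * `|K| / normc (D a)).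
have hM : `|c| * `|K| / normc (D a) < M%:R.
  by apply: archi_boundP; rewrite !mulr_ge0 // invr_ge0 ltW.
have := key M; rewrite mulrC -ler_pdivlMr // => /le_lt_trans /(_ hM).
by rewrite -natrX ltr_nat ltnNge ltnW // ltn_expl.
Qed.

Definition shift_seq a : nat -> C := fun l => a l.+1.

(** The binomial convolution sum_i C(l, i) a_i b_(l-i), defined through the Leibniz rule (fg)' = f'g
    + fg' so that inductions on l involve no binomial coefficient. *)
Fixpoint bconv a b (l : nat) {struct l} : C :=
  if l is l'.+1 then bconv (shift_seq a) b l' + bconv a (shift_seq b) l' else a
    0 * b 0.

Lemma bconv_at0 a b : bconv a b 0 = a 0 * b 0. Proof. by []. Qed.

Lemma bconvS a b l : bconv a b l.+1 = bconv (shift_seq a) b l + bconv a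
  (shift_seq b) l.
Proof. by []. Qed.

Lemma bconv_combl a b d x :
  bconv (fun l => a l + x * b l) d = fun l => bconv a d l + x * bconv b d l.
Proof.
apply/funext => l; elim: l a b d => [|l IH] a b d /=.
  by rewrite mulrDl mulrA.
by rewrite [in LHS](IH (shift_seq a)) (IH a) mulrDr addrACA.
Qed.

Lemma bconvC a b : bconv a b = bconv b a.
Proof.
apply/funext => l; elim: l a b => [|l IH] a b /=; first by rewrite mulrC.
by rewrite addrC IH [bconv _ b l]IH.
Qed.

Lemma bconv_combr a b d x :
  bconv d (fun l => a l + x * b l) = fun l => bconv d a l + x * bconv d b l.
Proof. by rewrite bconvC bconv_combl ![bconv d _]bconvC. Qed.

(** The recursion is that of the binomial expansion of (|r| + |s|)^l. A shift multiplies one of the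
    constants by its rate, so the constants vary in the induction. *)
Lemma bconv_geom a b c r d (s : R) : geom_bounded a c r -> geom_bounded b d s ->
  geom_bounded (bconv a b) (`|c| * `|d|) (`|r| + `|s|).
Proof.
move=> /geom_bounded_norm ha /geom_bounded_norm hb.
move: (normr_ge0 c) (normr_ge0 d) ha hb.
move: `|c| `|d| => {}c {}d.
move=> c0 d0 ha hb l; elim: l a b c d c0 d0 ha hb =>
  [|l IH] a b c d c0 d0 ha hb /=.
  rewrite expr0 mulr1 normcM.
  have := ha 0; have := hb 0; rewrite !expr0 !mulr1 => *.
  by apply: ler_pM => //; exact: normc_ge0.
apply: le_trans (le_normcD _ _) _.
have h1 := IH (shift_seq a) b (c * `|r|) d.
have h2 := IH a (shift_seq b) c (d * `|s|).
rewrite exprS mulrA mulrDr mulrDl; apply: lerD.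
  rewrite -[c * d * _]mulrAC; apply: h1 => //; first by rewrite mulr_ge0.
  by move=> i; rewrite -mulrA -exprS; exact: ha.
rewrite -[c * d * _]mulrA; apply: h2 => //; first by rewrite mulr_ge0.
by move=> i; rewrite -mulrA -exprS; exact: hb.
Qed.

Lemma subgeom_bconv a b : subgeom a -> subgeom b -> subgeom (bconv a b).
Proof.
move=> [c [r ha]] [d [s hb]]; do 2 eexists; exact: bconv_geom ha hb.
Qed.

Lemma shift_delta0 : shift_seq (delta_seq 0) = fun=> 0.
Proof. exact/funext. Qed.

Lemma shift_deltaS n : shift_seq (delta_seq n.+1) = delta_seq n.
Proof. exact/funext. Qed.

Lemma bconv0l a : bconv (fun=> 0) a = fun=> 0.
Proof.
apply/funext => l; elim: l a => [|l IH] a /=; first by rewrite mul0r.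
by rewrite [in LHS]IH [bconv _ _ _]IH addr0.
Qed.

Lemma bconv0r a : bconv a (fun=> 0) = fun=> 0.
Proof. by rewrite bconvC bconv0l. Qed.

(** The product of t^n / n! and t^m / m!; the Leibniz recursion turns into Pascal's rule. *)
Lemma bconv_delta n m l :
  bconv (delta_seq n) (delta_seq m) l = (l == n + m)%N%:R * 'C(n + m, n)%:R.
Proof.
elim: l n m => [|l IH] [|n] [|m]; rewrite ?bconvS ?bconv_at0 /delta_seq.
- by rewrite bin0.
- by rewrite mulr0 mul0r.
- by rewrite !mul0r.
- by rewrite !mul0r.
- by rewrite shift_delta0 bconv0l bconv0r addr0 mul0r.
- by rewrite shift_delta0 bconv0l add0r shift_deltaS IH !bin0.
- by rewrite shift_delta0 bconv0r addr0 shift_deltaS IH !addn0 !binn.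
have e1 : (n.+1 + m = (n + m).+1)%N by rewrite addSn.
have e2 : (n.+1 + m.+1 = (n + m).+2)%N by rewrite addSn addnS.
rewrite !shift_deltaS !IH e2 e1 addnS eqSS -mulrDr -natrD.
by rewrite [in RHS]binS; congr (_ * _%:R); exact: addnC.
Qed.

Lemma egf1_delta n : egf1 (delta_seq n) = (n`!%:R)^-1.
Proof.
rewrite (@egf1_fin _ n.+1); last first.
  by move=> l; rewrite /delta_seq; case: eqP => // ->; rewrite ltnn.
rewrite (bigD1 ord_max) //= /delta_seq eqxx mul1r big1 ?addr0 // => i ni.
by case: eqP => [e|]; rewrite ?mul0r //; case/eqP: ni; apply: val_inj.
Qed.

Lemma egf1_comb_geom a c r : geom_bounded a c r ->
  normc (egf1 a) <= `|c| * (2 * expR `|r|).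
Proof. by move=> /egf1_le; rewrite mulrCA. Qed.

(** With a fixed, both sides are bounded functionals of b. By commutativity this serves for each of
    the two factors in [egf1_bconv]. *)
Lemma egf1_bconv_density a : 
  (forall n, egf1 (bconv a (delta_seq n)) = egf1 a * egf1 (delta_seq n)) ->
    subgeom a ->
  forall b, subgeom b -> egf1 (bconv a b) = egf1 a * egf1 b.
Proof.
move=> h ba b bb; apply/eqP; rewrite -subr_eq0; apply/eqP.
apply: (density (D := fun b => egf1 (bconv a b) - egf1 a * egf1 b)) b bb.
- move=> b b' x bb bb'; rewrite bconv_combr !egf1_comb //;
  try exact: subgeom_bconv.
  ring.
- move=> r; have [c [r' ha]] := ba.
  exists (`|c| * (2 * expR (`|r'| + `|r|)) + normc (egf1 a) * (2 * expR `|r|)).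
  move=> b d hb; apply: le_trans (le_normcD _ _) _; rewrite normcN mulrDr.
  apply: lerD.
    have := egf1_comb_geom (bconv_geom ha hb).
    by rewrite normrM !normr_id (@ger0_norm _ (_ + _)) ?addr_ge0 // mulrA [`|d|
      * _]mulrC.
  rewrite normcM mulrCA; apply: ler_wpM2l; first exact: normc_ge0.
  exact: egf1_comb_geom.
- by move=> n; rewrite h subrr.
Qed.

Lemma egf1_bconv a b : subgeom a -> subgeom b ->
  egf1 (bconv a b) = egf1 a * egf1 b.
Proof.
move=> ba bb; apply: egf1_bconv_density => // n.
rewrite bconvC mulrC; apply: egf1_bconv_density => //;
  last exact: subgeom_delta.
move=> m; rewrite !egf1_delta (@egf1_fin _ (n + m).+1) => [|l]; last first.
  by rewrite bconv_delta; case: eqP => [->|]; rewrite ?ltnn ?mul0r.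
rewrite (bigD1 ord_max) //= big1 => [|i ni].
  rewrite addr0 bconv_delta eqxx mul1r; have := bin_fact (leq_addr m n).
  rewrite addKn => <-.
  rewrite !natrM !invfM mulVKf //.
  by rewrite pnatr_eq0 -lt0n bin_gt0 leq_addr.
rewrite bconv_delta; case: eqP => [e|]; rewrite ?mul0r //.
by case/eqP: ni; apply: val_inj.
Qed.

Definition egf t a : C := egf1 (fun l => t ^+ l * a l).
(** If f is the generating function of a, the l-th entry is the l-th derivative of f at s; the
    sequence is thus that of t |-> f(t + s). *)
Definition translate s a : nat -> C := fun l => egf s (fun i => a (i + l)%N).

Lemma geom_twist a c r t : geom_bounded a c r ->
  geom_bounded (fun l => t ^+ l * a l) c (normc t * r).
Proof.
move=> h l; rewrite normcM normcX exprMn mulrCA; apply: ler_wpM2l => //.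
by rewrite exprn_ge0 // normc_ge0.
Qed.

Lemma subgeom_twist a t : subgeom a -> subgeom (fun l => t ^+ l * a l).
Proof. by move=> [c [r h]]; exists c, (normc t * r); exact: geom_twist. Qed.

Lemma geom_drop a c r k : geom_bounded a c r ->
  geom_bounded (fun l => a (l + k)%N) (`|c| * `|r| ^+ k) `|r|.
Proof.
move=> /geom_bounded_norm h l; rewrite -mulrA -exprD addnC; exact: h.
Qed.

Lemma subgeom_drop a k : subgeom a -> subgeom (fun l => a (l + k)%N).
Proof. by move=> [c [r h]]; do 2 eexists; exact: geom_drop h. Qed.

Lemma subgeom_shift a : subgeom a -> subgeom (shift_seq a).
Proof.
by move=> /(@subgeom_drop _ 1); congr subgeom; apply/funext => l; rewrite addn1.
Qed.

Lemma egf_comb t a b x : subgeom a -> subgeom b ->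
  egf t (fun l => a l + x * b l) = egf t a + x * egf t b.
Proof.
move=> ba bb; rewrite /egf -egf1_comb; try exact: subgeom_twist.
by congr egf1; apply/funext => l; rewrite mulrDr mulrCA.
Qed.

Lemma egf_le t a c r : geom_bounded a c r ->
  normc (egf t a) <= `|c| * (2 * expR `|normc t * r|).
Proof. by move=> /(@geom_twist _ _ _ t) /egf1_comb_geom. Qed.

Lemma translate_comb s a b x : subgeom a -> subgeom b ->
  translate s (fun l => a l + x * b l) = fun l =>
    translate s a l + x * translate s b l.
Proof.
by move=> ba bb; apply/funext => l; rewrite /translate egf_comb //;
  exact: subgeom_drop.
Qed.

Lemma geom_translate s a c r : geom_bounded a c r ->
  geom_bounded (translate s a) (`|c| * (2 * expR (normc s * `|r|))) `|r|.
Proof.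
move=> h l; have /(@egf_le s) := geom_drop l h; rewrite -/(translate s a l).
rewrite [`|_ * `|r| |]ger0_norm ?mulr_ge0 ?normc_ge0 //.
rewrite [`|_ * `|r| ^+ l|]ger0_norm ?mulr_ge0 ?exprn_ge0 //.
by rewrite mulrAC.
Qed.

Lemma subgeom_translate s a : subgeom a -> subgeom (translate s a).
Proof. by move=> [c [r h]]; do 2 eexists; exact: geom_translate h. Qed.

Lemma sum_ord_pick (n k : nat) (F : nat -> C) : (k < n)%N ->
  \sum_(i < n) (i == k :> nat)%:R * F i = F k.
Proof.
move=> kn; rewrite (bigD1 (Ordinal kn)) //= eqxx mul1r big1 ?addr0 // => i ni.
by case: eqP => [e|]; rewrite ?mul0r //; case/eqP: ni; apply: val_inj.
Qed.

Lemma egf_delta t n : egf t (delta_seq n) = t ^+ n / n`!%:R.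
Proof.
rewrite /egf (@egf1_fin _ n.+1) => [|l]; last first.
  by rewrite /delta_seq; case: eqP => [->|]; rewrite ?ltnn ?mulr0.
rewrite -[RHS](@sum_ord_pick n.+1 n (fun l => t ^+ l / l`!%:R)) //.
by apply: eq_bigr => i _; rewrite /delta_seq [t ^+ i * _]mulrC -mulrA.
Qed.

Lemma translate_delta s n l : translate s (delta_seq n) l =
  if (l <= n)%N then s ^+ (n - l) / (n - l)`!%:R else 0.
Proof.
rewrite /translate; case: leqP => ln.
  rewrite -egf_delta; congr (egf s _); apply/funext => i; rewrite /delta_seq.
  by rewrite -(eqn_add2r l i) subnK.
rewrite /egf (@egf1_fin _ 0) ?big_ord0 // => i _.
by rewrite /delta_seq gtn_eqF ?mulr0 // (leq_trans ln) // leq_addl.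
Qed.

(** Taylor's formula at s, reduced by [density] to monomials, where it is the binomial theorem. *)
Lemma egf_translate t s a : subgeom a -> egf t (translate s a) = egf (t + s) a.
Proof.
move=> ba; apply/eqP; rewrite -subr_eq0; apply/eqP; move: a ba.
apply: (density (D := fun a => egf t (translate s a) - egf (t + s) a)).
- move=> a b x ba bb; rewrite translate_comb ?egf_comb //;
  try exact: subgeom_translate.
  ring.
- move=> r; exists ((2 * expR (normc s * `|r|)) * (2 * expR `|normc t * `|r| |)
  +
    (2 * expR `|normc (t + s) * r|)) => a c h.
  apply: le_trans (le_normcD _ _) _; rewrite normcN mulrDr.
  apply: lerD; last exact: egf_le.
  apply: le_trans (egf_le t (geom_translate s h)) _.
  rewrite normrM normr_id (@ger0_norm _ (2 * _)) ?mulr_ge0 ?expR_ge0 //.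
  by rewrite -[leLHS]mulrA.
move=> n; apply/eqP; rewrite subr_eq0; apply/eqP.
rewrite egf_delta /egf (@egf1_fin _ n.+1) => [|l nl]; last first.
  by rewrite translate_delta [(l <= n)%N]leqNgt nl mulr0.
rewrite addrC exprDn mulr_suml; apply: eq_bigr => i _.
have le_in : (i <= n)%N by rewrite -ltnS.
rewrite translate_delta le_in -(bin_fact le_in) mulrnAl -[RHS]mulr_natl.
have fact0 k : k`!%:R != 0 :> C by rewrite pnatr_eq0 -lt0n fact_gt0.
have b0 : 'C(n, i)%:R != 0 :> C by rewrite pnatr_eq0 -lt0n bin_gt0.
rewrite !natrM; move: (fact0 i) (fact0 (n - i)%N) b0.
move: (t ^+ i) (s ^+ _) (i`!%:R : C) ((n - i)`!%:R : C) ('C(n, i)%:R : C).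
by move=> u w p q r p0 q0 r0; field; rewrite p0 q0 r0.
Qed.

End OneParameter.

(** * The complex exponential *)

Section ComplexExponential.
Variable R : realType.
Local Notation C := (Cplx R).
Implicit Types (a b : nat -> C) (x y s t : C).

Definition cexp x : C := egf1 (fun l => x ^+ l).

Lemma subgeom_pow x : subgeom (fun l => x ^+ l).
Proof. by exists 1, (normc x) => l; rewrite normcX mul1r. Qed.

Lemma bconv_pow x y : bconv (fun l => x ^+ l) (fun l => y ^+ l) =
  fun l => (x + y) ^+ l.
Proof.
(* The scalars c and d make the claim stable under the shift, which multiplies x^l by x. *)
suff h (c d : C) l : bconv (fun l => c * x ^+ l) (fun l => d * y ^+ l) l =
    c * d * (x + y) ^+ l.
  apply/funext => l; rewrite -[RHS]mul1r -[X in X * _]mulr1 -h.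
  by congr (bconv _ _ _); apply/funext => i; rewrite mul1r.
elim: l c d => [|l IH] c d; first by rewrite bconv_at0 !expr0 !mulr1.
have shE (e z : C) : shift_seq (fun l => e * z ^+ l) = fun l =>
  (e * z) * z ^+ l.
  by apply/funext => i; rewrite /shift_seq exprS mulrA.
by rewrite bconvS !shE !IH exprS; ring.
Qed.

Lemma cexpD x y : cexp (x + y) = cexp x * cexp y.
Proof. by rewrite /cexp -bconv_pow egf1_bconv //; exact: subgeom_pow. Qed.

Lemma cexp0 : cexp 0 = 1.
Proof.
rewrite /cexp (@egf1_fin _ _ 1) => [|l l0]; last by rewrite expr0n eqn0Ngt l0.
by rewrite big_ord1 expr0 divr1.
Qed.

Lemma cexp_neq0 x : cexp x != 0.
Proof.
have e1 : cexp x * cexp (- x) = 1 by rewrite -cexpD subrr cexp0.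
by apply/eqP => x0; case/eqP: (oner_neq0 C); rewrite -e1 x0 mul0r.
Qed.

Lemma egf_pow t x : egf t (fun l => x ^+ l) = cexp (t * x).
Proof. by congr egf1; apply/funext => l; rewrite exprMn. Qed.

(** The two components have the shape of the coefficients of the cosine and sine series, with which
    [cexp_imag] compares them term by term. *)
Lemma expi_ReIm (y : R) l :
  (Complex 0 y : C) ^+ l =
  Complex ((~~ odd l)%:R * (-1) ^+ l./2 * y ^+ l)
          ((odd l)%:R * (-1) ^+ l.-1./2 * y ^+ l).
Proof.
have sq : (Complex 0 y : C) ^+ 2 = (- y ^+ 2)%:C%C.
  by rewrite expr2; apply: Cplx_ext; rewrite /= ?mul0r ?mulr0 ?add0r.
have ev2 k : (Complex 0 y : C) ^+ k.*2 = ((-1) ^+ k * y ^+ k.*2)%:C%C.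
  rewrite -mul2n exprM sq -rmorphXn.
  by apply: (congr1 (fun z : R => z%:C%C)); rewrite [LHS]exprNn -exprM.
have -> : l = (odd l + l./2.*2)%N by rewrite odd_double_half.
move: (odd l) l./2 => [] k /=.
  rewrite add1n exprSr ev2 /= doubleK odd_double.
  by apply: Cplx_ext => /=; rewrite ?exprSr; ring.
rewrite add0n ev2 doubleK odd_double.
by apply: Cplx_ext => /=; ring.
Qed.

Lemma cexp_real (r : R) : cexp r%:C%C = (expR r)%:C%C.
Proof.
have pw l : (r%:C%C : C) ^+ l = (r ^+ l)%:C%C by rewrite rmorphXn.
apply: Cplx_ext => /=.
  by congr (limn (series _)); apply/funext => l; rewrite /egf1_Re pw.
rewrite (_ : egf1_Im _ = fun=> 0); last first.
  by apply/funext => l; rewrite /egf1_Im pw mul0r.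
rewrite (_ : series _ = fun=> 0) ?lim_cst //.
by apply/funext => l; rewrite /series /= big1.
Qed.

Lemma cexp_imag (y : R) : cexp (Complex 0 y) = Complex (cos y) (sin y).
Proof.
rewrite cos.unlock sin.unlock; apply: Cplx_ext => /=.
  congr (limn (series _)); apply/funext => l.
  by rewrite /egf1_Re expi_ReIm /= /cos_coeff /= -exprnP.
congr (limn (series _)); apply/funext => l.
by rewrite /egf1_Im expi_ReIm /= /sin_coeff.
Qed.

Lemma cexpE (u w : R) :
  cexp (Complex u w) = Complex (expR u * cos w) (expR u * sin w).
Proof.
have -> : Complex u w = (u%:C%C : C) + Complex 0 w.
  by apply: Cplx_ext; rewrite /= ?addr0 ?add0r.
rewrite cexpD cexp_real cexp_imag.
by apply: Cplx_ext; rewrite /= !mul0r ?addr0 ?subr0.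
Qed.

Lemma two_pi_iE : two_pi_i R = Complex 0 (2 * pi).
Proof.
rewrite /two_pi_i (_ : 'i = Complex 0 1 :> C) //.
rewrite (_ : 2 = (2 : R)%:C%C) ?rmorph_nat //.
by apply: Cplx_ext => /=; ring.
Qed.

Lemma intCE (z : int) : z%:~R = (z%:~R : R)%:C%C :> C.
Proof. by rewrite rmorph_int. Qed.

Lemma two_pi_natE (k : nat) : 2 * pi * k%:R = pi *+ 2 *+ k :> R.
Proof. by rewrite mulr_natr [2 * _]mulr_natl. Qed.

Lemma cos_sin_periodz (x : R) (z : int) :
  cos (x + 2 * pi * z%:~R) = cos x /\ sin (x + 2 * pi * z%:~R) = sin x.
Proof.
case: z => k; first by rewrite -pmulrn two_pi_natE !(periodicn (@cosD2pi R),
  periodicn (@sinD2pi R)).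
rewrite NegzE mulrNz mulrN -pmulrn two_pi_natE.
by rewrite -(periodicn (@cosD2pi R) k.+1) -(periodicn (@sinD2pi R) k.+1) subrK.
Qed.

Lemma cexp_two_pi_i (z : int) : cexp (two_pi_i R * z%:~R) = 1.
Proof.
rewrite two_pi_iE (_ : _ * _ = Complex 0 (2 * pi * z%:~R)); last first.
  rewrite intCE.
  by apply: Cplx_ext => /=; ring.
have [hc hs] := cos_sin_periodz 0 z.
by rewrite cexp_imag -[_ * _]add0r hc hs cos0 sin0.
Qed.

Lemma cexp_periodic x y (z : int) :
  x - y = two_pi_i R * z%:~R -> cexp x = cexp y.
Proof. by move=> e; rewrite -(subrK y x) e cexpD cexp_two_pi_i mul1r. Qed.

(** The imaginary part gives sin w = 0, then the sign of the real part gives cos w = 1, hence u = 0.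
    Reducing w modulo 2 pi to y in [0, 2 pi), injectivity of cos on [0, pi] applies to y or to 2 pi
    - y. *)
Lemma cexp_eq1 x : cexp x = 1 -> exists z : int, x = two_pi_i R * z%:~R.
Proof.
case: x => u w; rewrite cexpE => -[ec es].
have sw : sin w = 0.
  by apply/eqP; move/eqP: es; rewrite mulf_eq0 expR_eq0.
have cw : cos w = 1.
  have := sin0cos1 sw; have : 0 <= cos w.
    by rewrite -(pmulr_rge0 _ (expR_gt0 u)) ec.
  by move=> /ger0_norm ->.
move: ec; rewrite cw mulr1 -expR0 => /expR_inj u0.
have p0 : 0 < 2 * pi :> R by rewrite mulr_gt0 // pi_gt0.
pose z := Num.floor (w / (2 * pi)); exists z.
have /andP[hz1 hz2] : z%:~R <= w / (2 * pi) < (z + 1)%:~R := floor_itv _.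
rewrite ler_pdivlMr // in hz1; rewrite ltr_pdivrMr // rmorphD /= in hz2.
pose y := w - 2 * pi * z%:~R.
have y0 : 0 <= y by rewrite subr_ge0 mulrC.
have y1 : y < 2 * pi.
  by rewrite ltrBlDl mulrC -[X in _ + X]mul1r -mulrDl.
have cy : cos y = 1.
  by rewrite /y -mulrN -mulrNz (cos_sin_periodz w (- z)).1.
have cos1_0 (t : R) : 0 <= t <= pi -> cos t = 1 -> t = 0.
  by move=> ht ct; rewrite -acos1 -ct cosK // in_itv.
have yE : y = 0.
  have [yp|yp] := lerP y pi; first by apply: cos1_0; rewrite ?y0.
  have e0 : 2 * pi - y = 0.
    apply: cos1_0; first by apply/andP; split; lra.
    by rewrite [2 * pi]mulr_natl addrC cosD2pi cosN.
  by move: y1; rewrite -subr_gt0 e0 ltxx.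
rewrite two_pi_iE intCE.
move/eqP: yE; rewrite subr_eq0 => /eqP wE.
by apply: Cplx_ext => /=; rewrite ?u0 ?wE; ring.
Qed.

End ComplexExponential.

(** * Exponential polynomials *)

Section ExponentialPolynomials.
Variable R : realType.
Local Notation C := (Cplx R).
Implicit Types (a b : nat -> C) (x y s t : C) (L : seq C) (G : set C).

(* On generating functions, [shift_sub x] is d/dt - x, so [exp_poly G a] says
   that sum_l a_l t^l / l! is an exponential polynomial with exponents in G. *)
Definition shift_sub x a : nat -> C := fun l => shift_seq a l + (- x) * a l.
Definition shift_prod L a : nat -> C := foldr shift_sub a L.

Definition exp_poly G a := exists L, (forall x, x \in L -> G x) /\
  shift_prod L a = fun=> 0.

Lemma shift_sub_comb z a b x : shift_sub z (fun l => a l + x * b l) =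
  fun l => shift_sub z a l + x * shift_sub z b l.
Proof. by apply/funext => l; rewrite /shift_sub /shift_seq; ring. Qed.

Lemma shift_prod_comb L a b x : shift_prod L (fun l => a l + x * b l) =
  fun l => shift_prod L a l + x * shift_prod L b l.
Proof. by elim: L => //= z L ->; rewrite shift_sub_comb. Qed.

Lemma shift_sub0 z : shift_sub z (fun=> 0) = fun=> 0.
Proof. by apply/funext => l; rewrite /shift_sub /shift_seq mulr0 addr0. Qed.

Lemma shift_prod0 L : shift_prod L (fun=> 0) = fun=> 0.
Proof. by elim: L => //= z L ->; rewrite shift_sub0. Qed.

Lemma shift_prod_shift L a : shift_prod L (shift_seq a) = shift_seq (shift_prod
  L a).
Proof. by elim: L => //= z L ->. Qed.

Lemma shift_prod_cat L L' a :
  shift_prod (L ++ L') a = shift_prod L (shift_prod L' a).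
Proof. by rewrite /shift_prod foldr_cat. Qed.

Lemma shift_prod_sub L x a :
  shift_prod L (shift_sub x a) = shift_sub x (shift_prod L a).
Proof.
by rewrite {1}/shift_sub shift_prod_comb shift_prod_shift.
Qed.

Lemma shift_prodC L L' a :
  shift_prod L (shift_prod L' a) = shift_prod L' (shift_prod L a).
Proof. by elim: L' => //= z L' <-; rewrite shift_prod_sub. Qed.

Lemma exp_poly0 G : exp_poly G (fun=> 0).
Proof. by exists [::]. Qed.

(** The operators d/dt - x commute, so the concatenated list annihilates both sequences. *)
Lemma exp_poly_comb G a b x : exp_poly G a -> exp_poly G b ->
  exp_poly G (fun l => a l + x * b l).
Proof.
move=> [L [GL La]] [L' [GL' Lb]]; exists (L ++ L'); split.
  by move=> z; rewrite mem_cat => /orP[/GL|/GL'].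
rewrite shift_prod_comb !shift_prod_cat Lb [shift_prod L (_ _ a)]shift_prodC La.
by rewrite !shift_prod0; apply/funext => l; rewrite mulr0 addr0.
Qed.

Lemma exp_poly_scale G a x : exp_poly G a -> exp_poly G (fun l => x * a l).
Proof.
move=> /(exp_poly_comb x (exp_poly0 G)); congr exp_poly.
by apply/funext => l; rewrite add0r.
Qed.

Lemma exp_polyD G a b : exp_poly G a -> exp_poly G b ->
  exp_poly G (fun l => a l + b l).
Proof.
move=> ha hb; have := exp_poly_comb 1 ha hb; congr exp_poly.
by apply/funext => l; rewrite mul1r.
Qed.

Lemma exp_poly_sum G (I : Type) (r : seq I) (P : pred I) (F : I -> nat -> C) :
  (forall i, P i -> exp_poly G (F i)) ->
  exp_poly G (fun l => \sum_(i <- r | P i) F i l).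
Proof.
move=> h; elim: r => [|i r IH].
  by rewrite (_ : (fun=> _) = fun=> 0); [exact: exp_poly0|apply/funext => l;
    rewrite big_nil].
case Pi: (P i); last first.
  by congr exp_poly: IH; apply/funext => l; rewrite big_cons Pi.
have := exp_polyD (h _ Pi) IH.
by congr exp_poly; apply/funext => l; rewrite big_cons Pi.
Qed.

Lemma exp_poly_shift_prod G L a : (forall x, x \in L -> G x) ->
  exp_poly G (shift_prod L a) -> exp_poly G a.
Proof.
move=> GL [L' [GL' h]]; exists (L' ++ L); split; last by rewrite shift_prod_cat.
by move=> z; rewrite mem_cat => /orP[/GL'|/GL].
Qed.

Lemma exp_poly_shift_sub G x a : G x ->
  exp_poly G (shift_sub x a) -> exp_poly G a.
Proof.
by move=> Gx; apply: (@exp_poly_shift_prod G [:: x]) => z; rewrite inE =>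
  /eqP ->.
Qed.

Lemma shift_sub_bconv x y a b : shift_sub (x + y) (bconv a b) =
  fun l => bconv (shift_sub x a) b l + bconv a (shift_sub y b) l.
Proof.
rewrite /shift_sub bconv_combl bconv_combr; apply/funext => l.
by rewrite [shift_seq (bconv _ _) _]bconvS; ring.
Qed.

(** Applying d/dt - (x + y) to a product gives two products, each with one exponent fewer in one
    factor; hence the induction on the total length of the two lists. An empty list means a zero
    factor. *)
Lemma exp_poly_bconv G a b : (forall x y, G x -> G y -> G (x + y)) ->
  exp_poly G a -> exp_poly G b -> exp_poly G (bconv a b).
Proof.
move=> GD [L [GL La]] [L' [GL' Lb]].
elim: {L L'}(size L + size L')%N {-2}L {-2}L' (leqnn (size L + size L')) a b
  GL GL' La Lb => [|k IH] [|x L] [|y L'] //= hk a b GL GL' La Lb.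
- by rewrite La bconv0l; exact: exp_poly0.
- by rewrite La bconv0l; exact: exp_poly0.
- by rewrite La bconv0l; exact: exp_poly0.
- by rewrite Lb bconv0r; exact: exp_poly0.
have Gx : G x by apply: GL; rewrite mem_head.
have Gy : G y by apply: GL'; rewrite mem_head.
have GL1 z : z \in L -> G z by move=> zL; apply: GL; rewrite inE zL orbT.
have GL1' z : z \in L' -> G z by move=> zL; apply: GL'; rewrite inE zL orbT.
apply: (exp_poly_shift_sub (GD _ _ Gx Gy)); rewrite shift_sub_bconv.
rewrite addSn ltnS in hk.
apply: exp_polyD.
- apply: (IH L (y :: L')) => //; last by rewrite shift_prod_sub.
- apply: (IH (x :: L) L') => //; first by rewrite /= addSn -addnS.
  by rewrite shift_prod_sub.
Qed.

Lemma exp_poly_subgeom G a : exp_poly G a -> subgeom a.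
Proof.
case=> L [_]; elim: L a => [|x L IH] a /=; first by move=> ->; exact: subgeom0.
rewrite -shift_prod_sub => /IH [c [r /geom_bounded_norm h]].
(* From a_(l+1) = (shift_sub x a)_l + x a_l: in r', the summand [normc x] pays for x a_l, the
   summand 1 for the inhomogeneous term, and |r| makes that term at most c' r'^l. The summand
   [normc (a 0)] of c' starts the induction. *)
pose c' := `|c| + normc (a 0); pose r' := normc x + `|r| + 1.
have c0 : 0 <= c' by rewrite addr_ge0 ?normc_ge0.
exists c', r'; elim=> [|l IHl]; first by rewrite expr0 mulr1 lerDr.
have -> : a l.+1 = shift_sub x a l + x * a l by rewrite /shift_sub /shift_seq;
  ring.
apply: le_trans (le_normcD _ _) _; rewrite normcM.
have hx : normc x * normc (a l) <= normc x * (c' * r' ^+ l).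
  by rewrite ler_wpM2l ?normc_ge0.
apply: le_trans (lerD (h l) hx) _.
have : `|c| * `|r| ^+ l <= c' * r' ^+ l.
  apply: ler_pM; rewrite ?exprn_ge0 ?lerDl ?normc_ge0 //.
  by apply: lerXn2r; rewrite ?nnegrE /r' ?addr_ge0 ?normc_ge0 // addrAC lerDr
    addr_ge0 ?normc_ge0.
move=> /lerD /(_ (lexx (normc x * (c' * r' ^+ l)))) /le_trans; apply.
rewrite exprS -subr_ge0.
have -> : c' * (r' * r' ^+ l) - (c' * r' ^+ l + normc x * (c' * r' ^+ l)) =
  `|r| * (c' * r' ^+ l) by rewrite [in r' * _]/r'; ring.
by rewrite !mulr_ge0 // exprn_ge0 // /r' !addr_ge0 ?normc_ge0.
Qed.

Lemma shift_sub_eq0 x a : shift_sub x a = (fun=> 0) -> a = fun l =>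
  a 0 * x ^+ l.
Proof.
move=> h; apply/funext; elim=> [|l IH]; first by rewrite expr0 mulr1.
have := congr1 (fun f => f l) h; rewrite /shift_sub /shift_seq mulNr => /eqP.
by rewrite subr_eq0 => /eqP ->; rewrite {1}IH exprS mulrCA.
Qed.

Lemma subgeom_scale a x : subgeom a -> subgeom (fun l => x * a l).
Proof.
move=> /(subgeom_comb x (subgeom0 R)); congr subgeom.
by apply/funext => l; rewrite add0r.
Qed.

Lemma egf0 t : egf t (fun=> 0) = 0.
Proof. by rewrite /egf (@egf1_fin _ _ 0) ?big_ord0 // => l _;
  rewrite mulr0. Qed.

Lemma egf_scale t a x : subgeom a -> egf t (fun l => x * a l) = x * egf t a.
Proof.
move=> ba; have := egf_comb t x (subgeom0 R) ba; rewrite egf0 add0r => <-.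
by congr egf; apply/funext => l; rewrite add0r.
Qed.

Lemma translate_shift_prod s L a : subgeom a ->
  translate s (shift_prod L a) = shift_prod L (translate s a) /\ subgeom
    (shift_prod L a).
Proof.
move=> ba; elim: L => //= z L [IH bL].
have bs := subgeom_comb (- z) (subgeom_shift bL) bL.
split=> //; rewrite -IH /shift_sub translate_comb //; last exact: subgeom_shift.
apply/funext => l; congr (_ + _); rewrite /shift_seq /translate; congr egf.
by apply/funext => i; rewrite addnS.
Qed.

Lemma translate_pow s x c : translate s (fun l => c * x ^+ l) =
  fun l => cexp (s * x) * (c * x ^+ l).
Proof.
apply/funext => l; rewrite /translate -egf_pow mulrC -egf_scale;
  last exact: subgeom_pow.
by congr egf; apply/funext => i; rewrite exprD [x ^+ i * _]mulrC mulrA.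
Qed.

Lemma bconv1l a : bconv (delta_seq R 0) a = a.
Proof.
apply/funext => l; elim: l a => [|l IH] a; first by rewrite bconv_at0 mul1r.
by rewrite bconvS shift_delta0 bconv0l add0r IH.
Qed.

(* The double eigenvalue: on the span of e^(xt) and t e^(xt), the translation
   by 1 is e^x times a nontrivial unipotent map. *)
Lemma double_eigenvalue x b c : subgeom b ->
  shift_sub x b = (fun l => c * x ^+ l) -> translate 1 b = (fun l =>
    cexp x * b l) ->
  c = 0.
Proof.
move=> bb hb /(congr1 (fun f => f 0)); rewrite /translate.
(* The sequence of t e^(xt). Solving the equation for b gives b_0 e^(xt) + c t e^(xt), whose value
   at 1 is compared with e^x b_0. *)
pose h := bconv (delta_seq R 1) (fun l => x ^+ l).
have bh : subgeom h by apply: subgeom_bconv;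
  [exact: subgeom_delta|exact: subgeom_pow].
have hE : b = fun l => b 0 * x ^+ l + c * h l.
  apply/funext; elim=> [|l IH].
    by rewrite /h bconv_at0 /delta_seq /= mul0r mulr0 addr0 expr0 mulr1.
  have := congr1 (fun f => f l) hb; rewrite /shift_sub /shift_seq => /eqP.
  rewrite mulNr subr_eq => /eqP ->; rewrite {1}IH /h bconvS shift_deltaS
    bconv1l.
  rewrite (_ : shift_seq _ = fun l => 0 + x * x ^+ l); last first.
    by apply/funext => i; rewrite add0r /shift_seq exprS.
  by rewrite bconv_combr bconv0r exprS; ring.
under [X in egf 1 X]funext do rewrite addn0.
rewrite [X in egf 1 X]hE egf_comb //; last first.
  by apply: subgeom_scale; exact: subgeom_pow.
rewrite egf_scale; last exact: subgeom_pow.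
rewrite egf_pow mul1r [egf 1 h](_ : _ = cexp x); last first.
  rewrite /egf (_ : (fun l => _) = h); last first.
    by apply/funext => l; rewrite expr1n mul1r.
  rewrite /h egf1_bconv; [|exact: subgeom_delta|exact: subgeom_pow].
  by rewrite egf1_delta invr1 mul1r.
rewrite [RHS]mulrC => /eqP; rewrite addrC -subr_eq0 addrK mulf_eq0.
by rewrite (negbTE (cexp_neq0 x)) orbF => /eqP.
Qed.

(* If x is the first exponent, [translate 1 a - e^x a] has one exponent less
   and vanishes at all natural numbers, so translate 1 a = e^x a by induction;
   this forces one of the first two exponents to be superfluous. *)
Lemma exp_poly_eq0 L a :
  {in L &, forall x y, cexp x = cexp y -> x = y} -> subgeom a ->
  shift_prod L a = (fun=> 0) -> (forall j : nat, egf j%:R a = 0) ->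
  a = fun=> 0.
Proof.
elim: {L}(size L) {-2}L (erefl (size L)) a =>
  [|k IH] [|x L] //= [sL] a inj ba La ea.
have pow0 z : shift_sub z a = (fun=> 0) -> a = fun=> 0.
  move=> /shift_sub_eq0 aE; have := ea 0.
  rewrite {1}aE egf_scale; last exact: subgeom_pow.
  rewrite egf_pow mul0r cexp0 mulr1 => a0; rewrite aE a0.
  by apply/funext => l; rewrite mul0r.
case: L sL inj La => [|y L] sL inj La; first exact: pow0 La.
have taua : translate 1 a = fun l => cexp x * a l.
  have b0 : subgeom (fun l => translate 1 a l + (- cexp x) * a l).
    by apply: subgeom_comb => //; exact: subgeom_translate.
  have : (fun l => translate 1 a l + (- cexp x) * a l) = fun=> 0.
    apply: (IH (y :: L) sL _ _ b0).
    - by move=> u w hu hw; apply: inj; rewrite inE ?hu ?hw orbT.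
    - rewrite shift_prod_comb -(translate_shift_prod _ _ ba).1.
      rewrite (shift_sub_eq0 La) translate_pow mul1r.
      by apply/funext => l; rewrite mulNr subrr.
    - move=> j; rewrite egf_comb //; last exact: subgeom_translate.
      by rewrite egf_translate // natr1 !ea mulr0 addr0.
  move=> h; apply/funext => l; have := congr1 (fun f => f l) h.
  by rewrite mulNr => /eqP; rewrite subr_eq0 => /eqP.
pose b := shift_prod L a; have [tb bb] := translate_shift_prod 1 L ba.
have taub : translate 1 b = fun l => cexp x * b l.
  rewrite tb taua; have := shift_prod_comb L (fun=> 0) a (cexp x).
  rewrite shift_prod0 => e; rewrite -[RHS]/(fun l => _).
  transitivity (fun l => 0 + cexp x * b l); last by apply/funext => l;
    rewrite add0r.
  by rewrite -e; congr shift_prod; apply/funext => l; rewrite add0r.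
pose c := shift_sub x b.
have bc : subgeom c by apply: subgeom_comb => //; exact: subgeom_shift.
have yc : shift_sub y c = fun=> 0.
  have := shift_prod_sub [:: y] x b; rewrite /= -/c => ->; exact: La.
have cE := shift_sub_eq0 yc.
have c00 : c 0 = 0.
  have [xy|xy] := eqVneq x y.
    by apply: (@double_eigenvalue x b (c 0)) => //; rewrite [LHS]cE xy.
  (* For x <> y, translation multiplies c both by e^x and by e^y, which are distinct by
     injectivity. *)
  have tc : translate 1 c = fun l => cexp x * c l.
    have := (translate_shift_prod 1 [:: x] bb).1 => /= ->; rewrite taub.
    by rewrite /c /shift_sub /shift_seq; apply/funext => l; ring.
  have : translate 1 c 0 = cexp y * c 0.
    by rewrite {1}cE translate_pow mul1r expr0 mulr1.
  rewrite tc => e; have [//|c0] := eqVneq (c 0) 0.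
  have h : x = y by apply: inj (mulIf c0 e); rewrite !inE eqxx ?orbT.
  by move: xy; rewrite h eqxx.
apply: (IH (x :: L) sL _ _ ba) => [||j]; last exact: ea.
  move=> u w hu hw; apply: inj; rewrite inE.
    by move: hu; rewrite inE => /orP[->|h] //; rewrite inE h !orbT.
  by move: hw; rewrite inE => /orP[->|h] //; rewrite inE h !orbT.
rewrite [LHS]/= -/b -/c cE c00.
by apply/funext => l; rewrite mul0r.
Qed.

End ExponentialPolynomials.

(** * Formal power series *)

Section PowerSeries.
Variables (n : nat) (K : comNzRingType).
Implicit Types (f g : fps n K) (m : multinom n).

(** Coefficients of products and derivatives of series are read off polynomials, where the algebraic
    identities are known. *)
Definition trunc (d : nat) f : mpoly n K :=
  \sum_(b : bmultinom n d) f b *: mpolyX K b.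

Lemma mcoeff_trunc d f m : (mdeg m < d)%N -> mcoeff m (trunc d f) = f m.
Proof.
move=> lt_md; rewrite /trunc raddf_sum /=.
rewrite (bigD1 (BMultinom lt_md)) //= mcoeffZ mcoeffX eqxx mulr1.
rewrite big1 ?addr0 // => i ne_im; rewrite mcoeffZ mcoeffX.
by move: ne_im; rewrite bmeqP /= => /negbTE ->; rewrite mulr0.
Qed.

Lemma fpsD f g m : (f + g) m = f m + g m. Proof. by []. Qed.

Lemma fps_mul_coef f g m : (f * g) m =
  \sum_(k : bmultinom n (mdeg m).+1 * bmultinom n (mdeg m).+1
        | m == mnm_add k.1 k.2) f k.1 * g k.2.
Proof. by []. Qed.

Lemma mul_trunc d f g m : (mdeg m < d)%N ->
  (f * g) m = mcoeff m (trunc d f * trunc d g).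
Proof.
move=> lt_md; rewrite mcoeffM fps_mul_coef; apply: eq_bigr => k _.
by rewrite !mcoeff_trunc //; exact: leq_trans (bmdeg _) lt_md.
Qed.

Definition monom (b : multinom n) : fps n K := fun m => (m == b)%:R.

Lemma monomD b b' : monom (mnm_add b b') = monom b * monom b'.
Proof.
apply/funext => m; rewrite (@mul_trunc (mdeg m + mdeg b + mdeg b').+1);
  last first.
  by rewrite ltnS -addnA leq_addr.
have tr (c : multinom n) d : (mdeg c < d)%N -> trunc d (monom c) = mpolyX K c.
  move=> lt_cd; rewrite /trunc (bigD1 (BMultinom lt_cd)) //= /monom eqxx
    scale1r.
  rewrite big1 ?addr0 // => i ne_ic.
  by move: ne_ic; rewrite bmeqP /= => /negbTE ->; rewrite scale0r.
rewrite !tr; last 2 first.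
- by rewrite ltnS leq_addl.
- by rewrite ltnS -addnAC leq_addl.
by rewrite -mpolyXD mcoeffX eq_sym.
Qed.

Lemma monom0 : monom mnm0 = 1.
Proof. by []. Qed.

End PowerSeries.

Section Derivation.
Variables (n : nat) (K : fieldType).
Implicit Types (f g : fps n K) (m : multinom n) (X : 'I_n -> fps n K).

(** The truncation keeps one more degree because derivation lowers the degree by one. *)
Lemma fps_deriv_trunc d i f m : (mdeg m < d)%N ->
  fps_deriv i f m = mcoeff m (mderiv i (trunc d.+1 f)).
Proof.
move=> lt_md; rewrite mcoeff_mderiv mcoeff_trunc //.
by rewrite mdegD mdeg1 addn1 ltnS.
Qed.

Lemma fps_derivM i f g :
  fps_deriv i (f * g) = fps_deriv i f * g + f * fps_deriv i g.
Proof.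
apply/funext => m; set d := (mdeg m).+1.
have dm : (mdeg m < d)%N by [].
have dm1 : (mdeg (mnm_add m (mnm1 i)) < d.+1)%N by rewrite mdegD mdeg1 addn1.
have dm' : (mdeg m < d.+1)%N by exact: ltnW.
have h1 := mul_trunc (fps_deriv i f) g dm'.
have h2 := mul_trunc f (fps_deriv i g) dm'.
rewrite fpsD h1 h2 {1}/fps_deriv (mul_trunc _ _ dm1) -mcoeff_mderiv.
rewrite mderivM mcoeffD !mcoeffM.
congr (_ + _); apply: eq_bigr => k _; congr (_ * _).
  rewrite [in RHS]mcoeff_trunc ?(leq_trans (bmdeg _)) //.
  by rewrite (@fps_deriv_trunc d) ?bmdeg.
rewrite [in RHS]mcoeff_trunc ?(leq_trans (bmdeg _)) //.
by rewrite (@fps_deriv_trunc d) ?bmdeg.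
Qed.

Lemma vf_actM X f g : vf_act X (f * g) = vf_act X f * g + f * vf_act X g.
Proof.
rewrite /vf_act mulr_suml mulr_sumr -big_split /=; apply: eq_bigr => i _.
by rewrite fps_derivM mulrDr mulrA mulrCA.
Qed.

Lemma vf_act_coef X f m : vf_act X f m = \sum_(i < n)
  \sum_(p : bmultinom n (mdeg m).+1 * bmultinom n (mdeg m).+1
        | m == mnm_add p.1 p.2)
    X i p.1 * (f (mnm_add p.2 (mnm1 i)) *+ (p.2 i).+1).
Proof. by rewrite /vf_act; elim/big_ind2: _ => // ? ? ? ? <- <-. Qed.

Lemma vf_act_comb X f g x : vf_act X (fun m => f m + x * g m) =
  fun m => vf_act X f m + x * vf_act X g m.
Proof.
apply/funext => m; rewrite !vf_act_coef mulr_sumr -big_split /=.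
apply: eq_bigr => i _; rewrite mulr_sumr -big_split /=.
by apply: eq_bigr => p _; rewrite mulrnDl mulrDr -mulrnAr mulrCA.
Qed.

Lemma vf_actD X f g : vf_act X (f + g) = vf_act X f + vf_act X g.
Proof.
have := vf_act_comb X f g 1.
rewrite (_ : (fun m => f m + _) = f + g); last by apply/funext => m;
  rewrite mul1r.
by move=> ->; apply/funext => m; rewrite mul1r.
Qed.

(** The degree lost in a partial derivative is regained from X_i, which has no constant term. *)
Lemma vf_act_eq X f g d : singular_vf X ->
  (forall m, (mdeg m <= d)%N -> f m = g m) ->
  forall m, (mdeg m <= d)%N -> vf_act X f m = vf_act X g m.
Proof.
move=> X0 fg m md; rewrite !vf_act_coef; apply: eq_bigr => i _.
apply: eq_bigr => p /eqP dE; have [p0|gt0p] := posnP (mdeg p.1).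
  have -> : bmnm p.1 = mnm0 by apply/eqP; rewrite -mdeg_eq0 p0.
  by rewrite X0 !mul0r.
rewrite fg // mdegD mdeg1 addn1; apply: leq_trans md.
by rewrite [X in (_ <= mdeg X)%N]dE mdegD -add1n leq_add2r.
Qed.

Lemma vf_act_at0 X f : singular_vf X -> vf_act X f mnm0 = 0.
Proof.
move=> X0; rewrite vf_act_coef; apply: big1 => i _; apply: big1 => p /eqP.
move=> /esym /eqP; rewrite mnmD_eq0 => /andP[/eqP -> _].
by rewrite X0 mul0r.
Qed.

Lemma vf_act_at1 X f j : singular_vf X -> 
  vf_act X f (mnm1 j) = \sum_(i < n) f (mnm1 i) * X i (mnm1 j).
Proof.
move=> X0; rewrite vf_act_coef; apply: eq_bigr => i _.
have h1 : (mdeg (mnm1 j) < (mdeg (mnm1 j)).+1)%N by [].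
have h0 : (mdeg (mnm0 : multinom n) < (mdeg (mnm1 j)).+1)%N by rewrite mdeg0.
rewrite (bigD1 (BMultinom h1, BMultinom h0)) /= ?addm0 // big1 ?addr0.
  by rewrite add0m mnm0E mulr1n mulrC.
move=> [p q] /andP[/eqP /= jE ne].
have [p0|p_gt0] := posnP (mdeg p).
  have -> : bmnm p = mnm0 by apply/eqP; rewrite -mdeg_eq0 p0.
  by rewrite X0 mul0r.
have e : 1%N = (mdeg p + mdeg q)%N by rewrite -mdegD -jE mdeg1.
have q0 : bmnm q = mnm0.
  by apply/eqP; rewrite -mdeg_eq0; move: e p_gt0; case: (mdeg p) =>
    // k [/esym /eqP]; rewrite addn_eq0 => /andP[].
have pj : bmnm p = mnm1 j by rewrite -[LHS]addm0 -q0 -jE.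
by case/eqP: ne; congr pair; apply: val_inj.
Qed.

End Derivation.

(** * The flow of a singular vector field *)

Section Orbits.
Variables (R : realType) (n : nat).
Local Notation C := (Cplx R).
Variable X : 'I_n -> fps n C.
Hypothesis X0 : singular_vf X.
Implicit Types (f g : fps n C) (m b : multinom n) (L : seq C) (G : set C).

(** Its generating function is the coefficient of x^m in f \o Exp(tX); d/dt replaces f by X(f). *)
Definition orbit f m : nat -> C := fun l => iter l (vf_act X) f m.

Lemma orbit_at0 f m : orbit f m 0 = f m. Proof. by []. Qed.

Lemma shift_orbit f m : shift_seq (orbit f m) = orbit (vf_act X f) m.
Proof. by apply/funext => l; rewrite /shift_seq /orbit iterSr. Qed.

Lemma orbit_comb f g x m : orbit (fun b => f b + x * g b) m =
  fun l => orbit f m l + x * orbit g m l.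
Proof.
apply/funext => l; rewrite /orbit.
suff -> : iter l (vf_act X) (fun b => f b + x * g b) =
   fun b => iter l (vf_act X) f b + x * iter l (vf_act X) g b by [].
by elim: l => //= l ->; rewrite vf_act_comb.
Qed.

Lemma orbitD f g m : orbit (f + g) m = fun l => orbit f m l + orbit g m l.
Proof.
apply/funext => l; rewrite /orbit.
suff -> : iter l (vf_act X) (f + g) = iter l (vf_act X) f + iter l (vf_act X) g.
  by [].
by elim: l => //= l ->; rewrite vf_actD.
Qed.

Lemma iter_vf_act0 l : iter l (vf_act X) (0 : fps n C) = 0.
Proof.
elim: l => //= l ->; have := vf_actD X 0 0; rewrite addr0 => /eqP.
by rewrite -subr_eq0 opprD addNKr oppr_eq0 => /eqP.
Qed.

Lemma orbit0 m : orbit 0 m = fun=> 0.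
Proof. by apply/funext => l; rewrite /orbit iter_vf_act0. Qed.

Lemma orbit_eq f g m : (forall b, (mdeg b <= mdeg m)%N -> f b = g b) ->
  orbit f m = orbit g m.
Proof.
move=> fg; apply/funext => l; rewrite /orbit.
suff h : forall b, (mdeg b <= mdeg m)%N ->
  iter l (vf_act X) f b = iter l (vf_act X) g b by exact: h.
elim: l => [|l IH] b bm; first exact: fg.
by rewrite !iterS; exact: (vf_act_eq X0 IH bm).
Qed.

Lemma orbit_at_mnm0 f : orbit f mnm0 = fun l => f mnm0 * delta_seq R 0 l.
Proof.
apply/funext => -[|l]; rewrite /delta_seq; first by rewrite eqxx mulr1.
by rewrite mulr0 /orbit iterS vf_act_at0.
Qed.

(** Both sides obey the Leibniz recursion. *)
Lemma orbitM f g m l : orbit (f * g) m l =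
  \sum_(k : bmultinom n (mdeg m).+1 * bmultinom n (mdeg m).+1
        | m == mnm_add k.1 k.2) bconv (orbit f k.1) (orbit g k.2) l.
Proof.
elim: l f g => [|l IH] f g; first by rewrite orbit_at0 fps_mul_coef.
rewrite -[LHS]/(shift_seq (orbit (f * g) m) l) shift_orbit vf_actM orbitD !IH
  -big_split /=.
by apply: eq_bigr => k _; rewrite !shift_orbit.
Qed.

Lemma orbit_sum (I : Type) (r : seq I) (F : I -> fps n C) m :
  orbit (\sum_(i <- r) F i) m = fun l => \sum_(i <- r) orbit (F i) m l.
Proof.
apply/funext => l; elim: r => [|i r IH]; first by rewrite !big_nil orbit0.
by rewrite !big_cons orbitD IH.
Qed.

Lemma orbit_scale f x m : orbit (fun b => x * f b) m = fun l => x * orbit f m l.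
Proof.
have := orbit_comb 0 f x m; rewrite orbit0 => e.
rewrite (_ : (fun b => x * f b) = (fun b => (0 : fps n C) b + x * f b)).
  by rewrite e; apply/funext => l; rewrite add0r.
by apply/funext => b; rewrite add0r.
Qed.

Lemma trunc_monom f m : forall b, (mdeg b <= mdeg m)%N ->
  f b = (\sum_(c : bmultinom n (mdeg m).+1)
          ((fun b => f c * monom C c b) : fps n C)) b.
Proof.
move=> b bm; have bm' : (mdeg b < (mdeg m).+1)%N by [].
have sumE (I : Type) (r : seq I) (F : I -> fps n C) :
  (\sum_(i <- r) F i) b = \sum_(i <- r) F i b.
  by elim: r => [|i r IH]; rewrite ?big_nil // !big_cons fpsD IH.
rewrite sumE (bigD1 (BMultinom bm')) //= /monom eqxx mulr1 big1 ?addr0 //.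
move=> c cb; case: eqP => [e|]; rewrite ?mulr0 //.
by case/eqP: cb; apply: val_inj.
Qed.

(** X does not lower the order, so only the finitely many terms of f of degree at most |m| matter
    and no infinite sum is exchanged with the iterates of X. *)
Lemma orbit_monom f m : orbit f m =
  fun l => \sum_(b : bmultinom n (mdeg m).+1) f b * orbit (monom C b) m l.
Proof.
rewrite (orbit_eq (trunc_monom f (m := m))) orbit_sum; apply/funext => l.
by apply: eq_bigr => b _; rewrite orbit_scale.
Qed.

Definition vf_prod L f : fps n C :=
  foldr (fun x g => (fun m => vf_act X g m + (- x) * g m)) f L.

Lemma orbit_vf_prod L f m : orbit (vf_prod L f) m = shift_prod L (orbit f m).
Proof.
elim: L => //= x L IH; rewrite orbit_comb -shift_orbit IH; exact/funext.
Qed.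

Definition lin_coef f : 'rV[C]_n := \row_j f (mnm1 j).

Lemma lin_coef_vf_act f : lin_coef (vf_act X f) = lin_coef f *m linear_part X.
Proof.
by apply/rowP => j; rewrite !mxE vf_act_at1 //; apply: eq_bigr => i _;
  rewrite !mxE.
Qed.

(** On linear coefficients X acts as right multiplication by its linear part A, so the product of
    the X - v_i acts as the characteristic polynomial of A evaluated at A. *)
Lemma lin_coef_vf_prod (v : 'I_n -> C) f : has_spectrum (linear_part X) v ->
  lin_coef (vf_prod (codom v) f) = 0.
Proof.
rewrite /has_spectrum => hv.
have [n0|n_gt0] := posnP n.
  by apply/rowP => j; exfalso; have := leq_trans (ltn_ord j) (eq_leq n0).
have [n' nE] : exists n', n = n'.+1 by exists n.-1; rewrite prednK.
have key L (A : 'M[C]_n'.+1) (u : 'rV[C]_n'.+1) :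
    foldr (fun x (w : 'rV[C]_n'.+1) => w *m A + (- x) *: w) u L =
    u *m horner_mx A (\prod_(x <- L) ('X - x%:P)).
  elim: L => [|x L IH] /=; first by rewrite big_nil rmorph1 mulmx1.
  rewrite big_cons mulrC rmorphM /= rmorphB /= horner_mx_X horner_mx_C.
  rewrite IH -mulmxE mulmxA mulmxBr mul_mx_scalar scaleNr //.
have lin L : lin_coef (vf_prod L f) =
    foldr (fun x w => w *m linear_part X + (- x) *: w) (lin_coef f) L.
  elim: L => //= x L <-; rewrite -lin_coef_vf_act.
  by apply/rowP => j; rewrite !mxE.
rewrite lin; move: (lin_coef f) (linear_part X) hv; clear lin X0 f.
move: v; rewrite {}nE => v u A hv; rewrite key.
rewrite (_ : \prod_(x <- _) _ = char_poly A); last first.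
  by rewrite hv big_map enumT.
by rewrite Cayley_Hamilton mulmx0.
Qed.

(* By induction on |m|: products of elements of the maximal ideal are dealt with
   by the Leibniz rule, linear forms by Cayley-Hamilton. *)
Lemma exp_poly_orbit G (v : 'I_n -> C) : has_spectrum (linear_part X) v ->
  G 0 -> (forall i, G (v i)) -> (forall x y, G x -> G y -> G (x + y)) ->
  forall f m, exp_poly G (orbit f m).
Proof.
move=> hv G0 Gv GD f m.
have base h : exp_poly G (orbit h mnm0).
  rewrite orbit_at_mnm0; apply: exp_poly_scale; apply: (exp_poly_shift_sub G0).
  rewrite (_ : shift_sub _ _ = fun=> 0); first exact: exp_poly0.
  by apply/funext => l; rewrite /shift_sub shift_delta0 oppr0 mul0r addr0.
elim: {m}(mdeg m) {-2}m (leqnn (mdeg m)) f => [|k IH] m mk f.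
  move: mk; rewrite leqn0 mdeg_eq0 => /eqP ->; exact: base.
have orbit_max0 g : max_ideal g -> orbit g mnm0 = fun=> 0.
  by move=> g0; rewrite orbit_at_mnm0 g0; apply/funext => l; rewrite mul0r.
(* Terms in which one factor contributes its constant coefficient vanish; in the others both degrees
   are below |m|, within reach of the induction hypothesis. *)
have prod_case g h : max_ideal g -> max_ideal h -> exp_poly G (orbit (g * h) m).
  move=> g0 h0; rewrite (_ : orbit _ _ = fun l =>
    \sum_(k : bmultinom n (mdeg m).+1 *
      bmultinom n (mdeg m).+1 | m == mnm_add k.1 k.2)
      bconv (orbit g k.1) (orbit h k.2) l); last by apply/funext => l;
        rewrite orbitM.
  apply: (@exp_poly_sum R G _ _ _ (fun k =>
    bconv (orbit g (bmnm k.1)) (orbit h (bmnm k.2)))).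
  move=> [p q] /= /eqP mE.
  have [/eqP|p_gt0] := posnP (mdeg p).
    rewrite mdeg_eq0 => /eqP ->; rewrite orbit_max0 // bconv0l;
      exact: exp_poly0.
  have [/eqP|q_gt0] := posnP (mdeg q).
    rewrite mdeg_eq0 => /eqP ->; rewrite orbit_max0 // bconv0r;
      exact: exp_poly0.
  have pqk : (mdeg p + mdeg q <= k.+1)%N by rewrite -mdegD -mE.
  apply: exp_poly_bconv => //; apply: IH; rewrite -ltnS; apply: leq_trans pqk.
    by rewrite -addn1 leq_add2l.
  by rewrite -add1n leq_add2r.
have monom_max b : (0 < mdeg b)%N -> max_ideal (monom C b).
  rewrite /max_ideal /monom /= eq_sym; case: eqP => // ->.
  by rewrite mdeg0.
(* A monomial of degree at least 2 splits as x_i times a monomial of positive degree. *)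
have order2 g : max_ideal g -> lin_coef g = 0 -> exp_poly G (orbit g m).
  move=> g0 g1; rewrite orbit_monom.
  apply: (@exp_poly_sum R G _ _ _ (fun c l =>
    g (bmnm c) * orbit (monom C c) m l)).
  move=> b _.
  case b1: (mdeg b == 1%N).
    case/mdeg1P: b1 => i /eqP ->.
    have := congr1 (fun u : 'rV_n => u 0 i) g1; rewrite !mxE => ->.
    rewrite (_ : (fun=> _) = fun=> 0); first exact: exp_poly0.
    by apply/funext => l; rewrite mul0r.
  have [/eqP|b_gt0] := posnP (mdeg b).
    rewrite mdeg_eq0 => /eqP ->; rewrite g0.
    rewrite (_ : (fun=> _) = fun=> 0); first exact: exp_poly0.
    by apply/funext => l; rewrite mul0r.
  apply: exp_poly_scale.
  have [i bi] : exists i, (0 < b i)%N.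
    apply/existsP; apply: contraLR b_gt0; rewrite negb_exists => /forallP h.
    rewrite -eqn0Ngt mdegE sum_nat_eq0; apply/forallP => i /=.
    by have := h i; rewrite -eqn0Ngt.
  have bE : bmnm b = mnm_add (mnm1 i) (mnm_sub b (mnm1 i)).
    apply/mnmP => j; rewrite mnmDE mnmBE mnm1E subnKC //.
    by case: eqP => [<-|].
  rewrite bE monomD; apply: prod_case; apply: monom_max; first by rewrite mdeg1.
  have := congr1 (@mdeg n) bE; rewrite mdegD mdeg1 => e.
  by rewrite lt0n; apply: contraFN b1 => /eqP h; rewrite e h.
(* The product of the X - v_i kills the linear coefficients of g and acts on the orbit as
   [shift_prod], with exponents in G. *)
have linear_case g : max_ideal g -> exp_poly G (orbit g m).
  move=> g0; apply: (@exp_poly_shift_prod _ _ (codom v)).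
    by move=> x /codomP[i ->].
  rewrite -orbit_vf_prod; apply: order2; last exact: lin_coef_vf_prod.
  rewrite /max_ideal /=; elim: (codom v) => //= x L h.
  by rewrite vf_act_at0 // h mulr0 addr0.
have [->|m0] := eqVneq m mnm0; first exact: base.
(* The constant term can be removed since X(1) = 0. *)
pose f0 : fps n C := fun b => f b + (- f mnm0) * (1 : fps n C) b.
have f00 : max_ideal f0.
  by rewrite /max_ideal /f0 /= /GRing.one /= /fps_one eqxx mulr1 subrr.
have orbit1 : orbit 1 m = fun=> 0.
  have d1 : vf_act X 1 = 0.
    have := vf_actM X 1 1; rewrite !mulr1 mul1r => /eqP.
    by rewrite -subr_eq0 opprD addNKr oppr_eq0 => /eqP.
  apply/funext => -[|l]; first by rewrite orbit_at0 -monom0 /monom (negbTE m0).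
  by rewrite /orbit iterSr d1 iter_vf_act0.
have := linear_case _ f00; rewrite /f0 orbit_comb orbit1.
by congr exp_poly; apply/funext => l; rewrite mulr0 addr0.
Qed.

End Orbits.

Lemma egf_bconv (R : realType) (t : Cplx R) (a b : nat -> Cplx R) :
  subgeom a -> subgeom b -> egf t (bconv a b) = egf t a * egf t b.
Proof.
move=> ba bb; rewrite /egf -egf1_bconv; try exact: subgeom_twist.
congr egf1; apply/funext => l.
suff h (c d : Cplx R) : bconv (fun i => c * (t ^+ i * a i)) (fun i =>
  d * (t ^+ i * b i)) l =
    c * d * (t ^+ l * bconv a b l).
  rewrite -[LHS]mul1r -[X in X * _ = _](mul1r 1) -h.
  by congr (bconv _ _ _); apply/funext => i; rewrite mul1r.
elim: l a b c d {ba bb} => [|l IH] a b c d; first by rewrite !bconv_at0; ring.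
rewrite !bconvS.
have shE (e : Cplx R) u : shift_seq (fun i => e * (t ^+ i * u i)) =
    fun i => (e * t) * (t ^+ i * shift_seq u i).
  by apply/funext => i; rewrite /shift_seq exprS; ring.
by rewrite !shE !IH exprS; ring.
Qed.

Lemma subgeom_sum (R : realType) (I : Type) (r : seq I) (P : pred I)
  (F : I -> nat -> Cplx R) :
  (forall i, P i -> subgeom (F i)) -> subgeom (fun l =>
    \sum_(i <- r | P i) F i l).
Proof.
move=> h; elim: r => [|i r IH].
  rewrite (_ : (fun=> _) = fun=> 0); first exact: subgeom0.
  by apply/funext => l; rewrite big_nil.
case Pi: (P i); last by congr subgeom: IH; apply/funext => l;
  rewrite big_cons Pi.
have := subgeom_comb 1 (h _ Pi) IH.
by congr subgeom; apply/funext => l; rewrite big_cons Pi mul1r.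
Qed.

Lemma egf_sum (R : realType) (t : Cplx R) (I : Type) (r : seq I) (P : pred I)
  (F : I -> nat -> Cplx R) :
  (forall i, P i -> subgeom (F i)) ->
  egf t (fun l => \sum_(i <- r | P i) F i l) = \sum_(i <- r | P i) egf t (F i).
Proof.
move=> h; elim: r => [|i r IH].
  rewrite big_nil -[RHS](egf0 t); congr egf.
  by apply/funext => l; rewrite big_nil.
rewrite big_cons -IH; case Pi: (P i); last first.
  by congr egf; apply/funext => l; rewrite big_cons Pi.
rewrite -[X in _ + X]mul1r -egf_comb; [|exact: h|exact: subgeom_sum].
by congr egf; apply/funext => l; rewrite big_cons Pi mul1r.
Qed.

Lemma egf_at0 (R : realType) (a : nat -> Cplx R) : egf 0 a = a 0.
Proof.
rewrite /egf (@egf1_fin _ _ 1) => [|l l0];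
  last by rewrite expr0n eqn0Ngt l0 mul0r.
by rewrite big_ord1 expr0 mul1r divr1.
Qed.

Lemma egf_at1 (R : realType) (a : nat -> Cplx R) : egf 1 a = egf1 a.
Proof. by congr egf1; apply/funext => l; rewrite expr1n mul1r. Qed.

Lemma prod_exp_mnm1 (n : nat) (A : comNzRingType) (F : 'I_n -> A) i :
  \prod_(j < n) F j ^+ (mnm1 i : multinom n) j = F i.
Proof.
rewrite (bigD1 i) //= mnm1E eqxx expr1 big1 ?mulr1 // => j ji.
by rewrite mnm1E eq_sym (negbTE ji) expr0.
Qed.

Lemma fps_comp_var (n : nat) (K : fieldType) (F : 'I_n -> fps n K) i :
  max_ideal (F i) -> fps_comp (fps_var K i) F = F i.
Proof.
move=> F0; apply/funext => m; rewrite /fps_comp /fps_var.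
(* For m = 0 the sum defining the composition stops before degree 1 and misses x_i; F_i having no
   constant term makes both sides 0. *)
have [/eqP|m_gt0] := posnP (mdeg m).
  rewrite mdeg_eq0 => /eqP ->; rewrite F0 big1 // => b _.
  case: eqP => [bE|_]; last by rewrite mul0r.
  by have := bmdeg b; rewrite bE mdeg1 mdeg0.
have h : (mdeg (mnm1 i) < (mdeg m).+1)%N by rewrite mdeg1.
rewrite (bigD1 (BMultinom h)) //= eqxx mul1r [X in _ + X]big1 ?addr0.
  by rewrite prod_exp_mnm1.
move=> b; rewrite bmeqP /= => /negbTE ->.
by rewrite mul0r.
Qed.

Section Flow.
Variables (R : realType) (n : nat).
Local Notation C := (Cplx R).
Variable X : 'I_n -> fps n C.
Hypothesis X0 : singular_vf X.
Variable v : 'I_n -> C.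
Hypothesis hv : has_spectrum (linear_part X) v.
Implicit Types (f g : fps n C) (m : multinom n) (s t : C).

(** Convergence is a by-product of the exponential polynomial structure, with all complex numbers
    allowed as exponents. *)
Lemma subgeom_orbit f m : subgeom (orbit X f m).
Proof. exact: (exp_poly_subgeom (exp_poly_orbit (G := setT) X0 hv _ _ _ f m)).
  Qed.

(* f \o Exp (t X) *)
Definition flow t f : fps n C := fun m => egf t (orbit X f m).

Definition flow_map t : 'I_n -> fps n C := fun i => flow t (fps_var C i).

Lemma flowM t f g : flow t (f * g) = flow t f * flow t g.
Proof.
apply/funext => m; rewrite fps_mul_coef /flow.
rewrite (_ : orbit X (f * g) m = fun l => \sum_(k : bmultinom n (mdeg m).+1 *
      bmultinom n (mdeg m).+1 | m == mnm_add k.1 k.2)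
      bconv (orbit X f k.1) (orbit X g k.2) l); last by apply/funext => l;
        rewrite orbitM.
rewrite (@egf_sum _ _ _ _ _ (fun k => bconv (orbit X f (bmnm k.1)) (orbit X g
  (bmnm k.2)))).
  by apply: eq_bigr => k _; rewrite egf_bconv //; exact: subgeom_orbit.
by move=> k _; apply: subgeom_bconv; exact: subgeom_orbit.
Qed.

Lemma flow_monom_sum t f m : flow t f m =
  \sum_(b : bmultinom n (mdeg m).+1) f b * flow t (monom C b) m.
Proof.
rewrite /flow orbit_monom //.
rewrite (@egf_sum _ _ _ _ _ (fun b l => f (bmnm b) * orbit X (monom C b) m l)).
  by apply: eq_bigr => b _; rewrite egf_scale //; exact: subgeom_orbit.
by move=> b _; apply: subgeom_scale; exact: subgeom_orbit.
Qed.

Lemma flow1 t : flow t 1 = 1.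
Proof.
apply/funext => m; rewrite /flow (_ : orbit X 1 m = fun l =>
  (1 : fps n C) m * delta_seq R 0 l).
  by rewrite egf_scale ?egf_delta ?expr0 ?divr1 ?mulr1 //; exact: subgeom_delta.
have d1 : vf_act X 1 = 0.
  have := vf_actM X 1 1; rewrite !mulr1 mul1r => /eqP.
  by rewrite -subr_eq0 opprD addNKr oppr_eq0 => /eqP.
apply/funext => -[|l]; rewrite /delta_seq; first by rewrite eqxx mulr1.
by rewrite mulr0 /orbit iterSr d1 iter_vf_act0.
Qed.

Lemma flow_monom t (b : multinom n) :
  flow t (monom C b) = \prod_(i < n) flow_map t i ^+ b i.
Proof.
elim: {b}(mdeg b) {-2}b (erefl (mdeg b)) => [|k IH] b bk.
  move/eqP: bk; rewrite mdeg_eq0 => /eqP ->; rewrite monom0 flow1 big1 // =>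
    i _.
  by rewrite mnm0E expr0.
have [i bi] : exists i, (0 < b i)%N.
  apply/existsP; have : mdeg b != 0%N by rewrite bk.
  apply: contraR; rewrite negb_exists => /forallP h.
  rewrite mdegE sum_nat_eq0; apply/forallP => i /=.
  by have := h i; rewrite -eqn0Ngt.
have bE : b = mnm_add (mnm1 i) (mnm_sub b (mnm1 i)).
  apply/mnmP => j; rewrite mnmDE mnmBE mnm1E subnKC //.
  by case: eqP => [<-|].
have b1 : mdeg (mnm_sub b (mnm1 i)) = k.
  by apply/succn_inj; rewrite -bk {2}bE mdegD mdeg1.
rewrite bE monomD flowM (IH _ b1).
under [RHS]eq_bigr do rewrite mnmDE exprD.
by rewrite big_split /= prod_exp_mnm1.
Qed.

(** The flow is unital and multiplicative, and at each coefficient it depends on finitely many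
    monomials; it is therefore substitution of the images of the coordinates. *)
Lemma fps_comp_flow t f : fps_comp f (flow_map t) = flow t f.
Proof.
apply/funext => m; rewrite flow_monom_sum; apply: eq_bigr => b _.
by rewrite flow_monom.
Qed.

(** A coefficient of X(f) is a finite combination of coefficients of f with weights independent of
    t. *)
Lemma flow_vf_act t f : flow t (vf_act X f) = vf_act X (flow t f).
Proof.
apply/funext => m; rewrite vf_act_coef {1}/flow.
rewrite (_ : orbit X (vf_act X f) m = fun l => \sum_(i < n)
  \sum_(p : bmultinom n (mdeg m).+1 * bmultinom n (mdeg m).+1
        | m == mnm_add p.1 p.2)
    X i p.1 *+ (bmnm p.2 i).+1 * orbit X f (mnm_add p.2 (mnm1 i)) l);
      last first.
  apply/funext => l; rewrite -shift_orbit /shift_seq /orbit iterS vf_act_coef.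
  by apply: eq_bigr => i _; apply: eq_bigr => p _; rewrite mulrnAl mulrnAr.
have bF i : subgeom (fun l =>
  \sum_(p : bmultinom n (mdeg m).+1 * bmultinom n (mdeg m).+1
        | m == mnm_add p.1 p.2)
    X i p.1 *+ (bmnm p.2 i).+1 * orbit X f (mnm_add p.2 (mnm1 i)) l).
  by apply: subgeom_sum => p _; apply: subgeom_scale; exact: subgeom_orbit.
rewrite egf_sum //; apply: eq_bigr => i _.
rewrite egf_sum => [|p _]; last by apply: subgeom_scale; exact: subgeom_orbit.
apply: eq_bigr => p _; rewrite egf_scale; last exact: subgeom_orbit.
by rewrite mulrnAl mulrnAr.
Qed.

(** As the flow commutes with X, the l-th term is the l-th derivative at t of the coefficient
    function. The group law is then Taylor's formula. *)
Lemma orbit_flow t f m : orbit X (flow t f) m = translate t (orbit X f m).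
Proof.
apply/funext => l; rewrite /orbit.
have -> : iter l (vf_act X) (flow t f) = flow t (iter l (vf_act X) f).
  by elim: l => //= l ->; rewrite flow_vf_act.
by rewrite /translate /flow; congr egf; apply/funext => i; rewrite /orbit iterD.
Qed.

Lemma flowD s t f : flow s (flow t f) = flow (s + t) f.
Proof.
by apply/funext => m; rewrite /flow -/(flow t f) orbit_flow egf_translate //;
  exact: subgeom_orbit.
Qed.

Lemma flow_at0 f : flow 0 f = f.
Proof. by apply/funext => m; rewrite /flow egf_at0. Qed.

Lemma flow_map0 : flow_map 0 = @fps_var n C.
Proof. by apply/funext => i; rewrite /flow_map flow_at0. Qed.

Lemma flow_mapD s t : Defs.map_comp (flow_map s) (flow_map t)
  = flow_map (s + t).
Proof.
by apply/funext => i; rewrite /Defs.map_comp fps_comp_flow flowD addrC.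
Qed.

Lemma flow_max_ideal t f : max_ideal f -> max_ideal (flow t f).
Proof.
rewrite /max_ideal /= => f0; rewrite /flow orbit_at_mnm0 // egf_scale ?f0
  ?mul0r //.
exact: subgeom_delta.
Qed.

Lemma flow_map_max_ideal t i : max_ideal (flow_map t i).
Proof.
by apply: flow_max_ideal; rewrite /max_ideal /= /fps_var eq_sym mnm1_eq0.
Qed.

Lemma orbit_at1 f j : orbit X f (mnm1 j) =
  fun l => (lin_coef f *m (linear_part X) ^+ l) 0 j.
Proof.
apply/funext => l; suff <- : lin_coef (iter l (vf_act X) f) =
  lin_coef f *m (linear_part X) ^+ l by rewrite mxE.
elim: l => [|l IH]; first by rewrite expr0 mulmx1.
by rewrite iterS lin_coef_vf_act // IH exprSr mulmxA.
Qed.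

Lemma lin_coef_var i : lin_coef (fps_var C i) = (delta_mx 0 i : 'rV[C]_n).
Proof.
apply/rowP => j; rewrite !mxE /fps_var eqxx andTb.
suff -> : (mnm1 j == mnm1 i :> multinom n) = (j == i) by [].
apply/eqP/eqP => [e|-> //].
have := congr1 (fun b : multinom n => b i) e; rewrite !mnm1E eqxx.
by case: eqP.
Qed.

Lemma linear_part_flow t i j : linear_part (flow_map t) i j =
  egf t (fun l => ((linear_part X) ^+ l) i j).
Proof.
rewrite mxE /flow_map /flow orbit_at1 lin_coef_var; congr egf.
by apply/funext => l; rewrite -rowE mxE.
Qed.

Lemma flow_at1 t f j :
  flow t f (mnm1 j) = (lin_coef f *m linear_part (flow_map t)) 0 j.
Proof.
have bX k : subgeom (fun l => (linear_part X ^+ l) k j).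
  have := subgeom_orbit (fps_var C k) (mnm1 j); rewrite orbit_at1 lin_coef_var.
  by congr subgeom; apply/funext => l; rewrite -rowE mxE.
rewrite mxE /flow orbit_at1.
rewrite (_ : (fun l => _) = fun l =>
   \sum_k lin_coef f 0 k * ((linear_part X) ^+ l) k j); last first.
  by apply/funext => l; rewrite mxE.
rewrite egf_sum => [|k _]; last exact: subgeom_scale.
by apply: eq_bigr => k _; rewrite egf_scale // linear_part_flow.
Qed.

Lemma flow_map_diff t : formal_diff (flow_map t).
Proof.
split=> [i|]; first exact: flow_map_max_ideal.
suff : linear_part (flow_map (- t)) *m linear_part (flow_map t) = 1%:M.
  by case/mulmx1_unit.
apply/row_matrixP => i; rewrite row_mul row1.
have -> : row i (linear_part (flow_map (- t))) = lin_coef (flow_map (- t) i).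
  by apply/rowP => j; rewrite !mxE.
apply/rowP => j; rewrite -flow_at1 /flow_map flowD subrr flow_at0.
have := congr1 (fun u : 'rV[C]_n => u 0 j) (lin_coef_var i).
by rewrite mxE.
Qed.

Lemma is_exp_flow : is_exp X (flow_map 1).
Proof.
split; first exact: flow_map_diff.
move=> g m; rewrite fps_comp_flow /flow egf_at1.
exact: (egf1P (subgeom_orbit g m)).
Qed.

(** [Exp] is a choice among the maps satisfying [is_exp]; applied to the coordinates, the condition
    determines each component as a limit. *)
Lemma Exp_flow : Exp X = flow_map 1.
Proof.
have [[F0 _] hF] : is_exp X (Exp X) by apply: xgetPex; exists (flow_map 1);
  exact: is_exp_flow.
apply/funext => i; apply/funext => m.
have := hF (fps_var C i) m; rewrite fps_comp_var // => h.
have := is_exp_flow.2 (fps_var C i) m; rewrite fps_comp_var; last first.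
  exact: flow_map_max_ideal.
exact: (cvg_unique _ h).
Qed.

Lemma flow_map_cyclic (j : nat) : cyclic_diff (Exp X) (flow_map j%:R).
Proof.
move=> H [[_ H1 HM _] HF].
elim: j => [|j IH]; first by rewrite flow_map0.
have -> : flow_map j.+1%:R = Defs.map_comp (flow_map j%:R) (flow_map 1).
  by rewrite flow_mapD natr1.
apply: HM; first exact: IH.
by apply: HF; rewrite /= Exp_flow.
Qed.

(** The flow at integer times is a subgroup containing [Exp X]. *)
Lemma cyclic_flow_map F : cyclic_diff (Exp X) F ->
  exists z : int, F = flow_map z%:~R.
Proof.
move=> /(_ [set G | exists z : int, G = flow_map z%:~R]); apply.
split; last by move=> G ->; exists 1; rewrite Exp_flow.
split.
- by move=> G [z ->]; exact: flow_map_diff.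
- by exists 0; rewrite flow_map0.
- by move=> G H [z ->] [w ->]; exists (z + w); rewrite flow_mapD rmorphD.
- move=> G [z ->]; exists (flow_map (- z)%:~R); first by exists (- z).
  have zN : (- z)%:~R = - (z%:~R) :> C by rewrite rmorphN.
  by split; rewrite flow_mapD zN ?subrr ?addNr; exact: flow_map0.
Qed.

End Flow.

(** * Regular functions along the flow *)

Lemma mpoly_ind_alg (K : fieldType) (M : nat) (P : mpoly M K -> Prop) :
  P 1 -> (forall i, P (mpolyX K (mnm1 i))) ->
  (forall p q, P p -> P q -> P (p + q)) -> (forall c p, P p -> P (c *: p)) ->
  (forall p q, P p -> P q -> P (p * q)) -> forall p, P p.
Proof.
move=> P1 PX PD PZ PM p.
have P0 : P 0 by rewrite -(scale0r 1); exact: PZ.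
rewrite (mpolyE p); elim/big_ind: _ => // m _; apply: PZ.
rewrite mpolyXE_id; elim/big_ind: _ => // i _.
by elim: (m i) => [|k IH]; rewrite ?expr0 // exprS; exact: PM.
Qed.

Section TangentVector.
Variables (N : nat) (K : fieldType) (B : 'M[K]_N).
Implicit Types (p q : mpoly (N * N) K).

(** The derivative of p at 1 in the direction B, as it occurs in [lie_algebra]. *)
Definition tangent p : K :=
  \sum_(i < N * N) mx_eval (mderiv i p) 1%:M * mxvec B 0 i.

Lemma tangentD p q : tangent (p + q) = tangent p + tangent q.
Proof.
rewrite /tangent -big_split /=; apply: eq_bigr => i _.
by rewrite mderivD /mx_eval mevalD mulrDl.
Qed.

Lemma tangentZ c p : tangent (c *: p) = c * tangent p.
Proof.
rewrite /tangent mulr_sumr; apply: eq_bigr => i _.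
by rewrite mderivZ /mx_eval mevalZ mulrA.
Qed.

Lemma tangent0 : tangent 0 = 0.
Proof. by have := tangentZ 0 0; rewrite scale0r mul0r. Qed.

Lemma tangentM p q : tangent (p * q) =
  tangent p * mx_eval q 1%:M + mx_eval p 1%:M * tangent q.
Proof.
rewrite /tangent mulr_suml mulr_sumr -big_split /=; apply: eq_bigr => i _.
by rewrite mderivM /mx_eval mevalD !mevalM mulrDl mulrAC mulrA.
Qed.

Lemma tangent1 : tangent 1 = 0.
Proof.
rewrite /tangent big1 // => i _.
by rewrite -mpolyC1 mderivC /mx_eval meval0 mul0r.
Qed.

Lemma tangentX i j : tangent (mpolyX K (mnm1 (mxvec_index i j))) = B i j.
Proof.
rewrite /tangent (bigD1 (mxvec_index i j)) //= mxvecE big1 ?addr0.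
  rewrite mderivX /mx_eval mevalZ mnm1E eqxx mul1r.
  rewrite (_ : mnm_sub _ _ = mnm0) ?mpolyX0 ?meval1 ?mul1r //.
  by apply/mnmP => k; rewrite mnmBE subnn mnm0E.
move=> k ki; rewrite mderivX /mx_eval mevalZ mnm1E eq_sym (negbTE ki).
by rewrite !mul0r.
Qed.

Lemma mx_evalX i j (A : 'M[K]_N) :
  mx_eval (mpolyX K (mnm1 (mxvec_index i j))) A = A i j.
Proof. by rewrite /mx_eval mevalXU mxvecE. Qed.

Lemma zariski_closure_vanishes (S : set 'M[K]_N) p :
  vanishes_on S p -> vanishes_on (zariski_closure S) p.
Proof. by move=> Sp A [_]; exact. Qed.

Lemma zariski_closure_sub (S : set 'M[K]_N) A :
  S A -> A \in unitmx -> zariski_closure S A.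
Proof. by move=> SA uA; split=> // p; exact. Qed.

End TangentVector.

(** * Jets of the flow: without weak resonance, X lies in the Lie algebra *)

Section JetFlow.
Variables (R : realType) (n : nat).
Local Notation C := (Cplx R).
Variable X : 'I_n -> fps n C.
Hypothesis X0 : singular_vf X.
Variable v : 'I_n -> C.
Hypothesis hv : has_spectrum (linear_part X) v.
Variable k : nat.
Local Notation N := #|jet_monom n k|.
Local Notation flow_map := (flow_map X).
Local Notation flow := (flow X).

Lemma jet_lift_delta (i : 'I_N) :
  jet_lift (delta_mx 0 i) = monom C (jet_exponent i).
Proof.
apply/funext => m; rewrite /jet_lift (bigD1 i) //= mxE !eqxx mul1r.
by rewrite big1 ?addr0 // => j /negbTE ne_ji; rewrite mxE ne_ji andbF mul0r.
Qed.

Definition jet_orbit (i j : 'I_N) := orbit X (monom C (jet_exponent i))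
  (jet_exponent j).

Lemma jet_mx_flow t i j : jet_mx k (flow_map t) i j = egf t (jet_orbit i j).
Proof. by rewrite !mxE jet_lift_delta (fps_comp_flow X0 hv). Qed.

Lemma jet_vf_mx_orbit i j : jet_vf_mx k X i j = jet_orbit i j 1.
Proof. by rewrite !mxE jet_lift_delta. Qed.

Lemma jet_exponent_inj : injective (@jet_exponent n k).
Proof. by move=> i j e; apply: enum_val_inj; exact: val_inj. Qed.

Lemma jet_orbit_at0 i j : jet_orbit i j 0 = (1%:M : 'M[C]_N) i j.
Proof.
by rewrite /jet_orbit orbit_at0 /monom mxE (inj_eq jet_exponent_inj) eq_sym.
Qed.

Lemma jet_mx_flow0 : jet_mx k (flow_map 0) = 1%:M.
Proof. by apply/matrixP => i j; rewrite jet_mx_flow egf_at0 jet_orbit_at0. Qed.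

Lemma monom_max_ideal (i : 'I_N) : max_ideal (monom C (jet_exponent i)).
Proof.
rewrite /max_ideal /monom /= eq_sym; case: eqP => // e.
by have := enum_valP i; rewrite unfold_in /jet_monom -[bmnm _]/(jet_exponent i)
  e mdeg0.
Qed.

(** This provides invertibility of the jet matrices, which membership in the Zariski closure
    requires. *)
Lemma jet_mx_flowD s t :
  jet_mx k (flow_map (s + t)) = jet_mx k (flow_map s) *m jet_mx k (flow_map t).
Proof.
apply/row_matrixP => i; rewrite row_mul.
set f := monom C (jet_exponent i).
have jetE u : row i (jet_mx k (flow_map u)) = jet k (flow u f).
  by apply/rowP => j; rewrite mxE jet_mx_flow mxE.
have max_f : max_ideal (flow s f).
  by apply: flow_max_ideal => //; exact: monom_max_ideal.
apply: etrans (jetE (s + t)) _; apply: esym.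
apply: etrans (congr1 (mulmx^~ (jet_mx k (flow_map t))) (jetE s)) _.
apply: etrans (jet_mxE k (flow_map t) max_f) _.
by rewrite (fps_comp_flow X0 hv t (flow s f)) (flowD X0 hv) addrC.
Qed.

Lemma jet_mx_flow_unit t : jet_mx k (flow_map t) \in unitmx.
Proof.
have h : jet_mx k (flow_map t) *m jet_mx k (flow_map (- t)) = 1%:M.
  by rewrite -jet_mx_flowD subrr jet_mx_flow0.
exact: (mulmx1_unit h).1.
Qed.

(** Polynomials are generated as an algebra by the matrix entries, whose sequences are orbits. The
    value a 0 is carried along because the Leibniz rule for a 1 involves it. *)
Lemma mx_eval_flow (G : set C) (p : mpoly (N * N) C) :
  G 0 -> (forall i, G (v i)) -> (forall x y, G x -> G y -> G (x + y)) ->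
  exists a, [/\ exp_poly G a,
    forall t, egf t a = mx_eval p (jet_mx k (flow_map t)),
    a 0 = mx_eval p 1%:M & a 1 = tangent (jet_vf_mx k X) p].
Proof.
move=> G0 Gv GD; elim/mpoly_ind_alg: p.
- exists (delta_seq R 0); split=> [|t||].
  + apply: (exp_poly_shift_sub G0); rewrite (_ : shift_sub _ _ = fun=> 0).
      exact: exp_poly0.
    by apply/funext => l; rewrite /shift_sub shift_delta0 oppr0 mul0r addr0.
  + by rewrite egf_delta expr0 divr1 /mx_eval meval1.
  + by rewrite /mx_eval meval1.
  + by rewrite tangent1.
- case/mxvec_indexP=> i j; exists (jet_orbit i j); split=> [|t||].
  + exact: (exp_poly_orbit X0 hv).
  + by rewrite mx_evalX jet_mx_flow.
  + by rewrite mx_evalX jet_orbit_at0.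
  + by rewrite tangentX jet_vf_mx_orbit.
- move=> p q [a [ea ta a0 a1]] [b [eb tb b0 b1]].
  have ba := exp_poly_subgeom ea; have bb := exp_poly_subgeom eb.
  exists (fun l => a l + 1 * b l); split=> [|t||].
  + exact: exp_poly_comb.
  + by rewrite (egf_comb _ _ ba bb) ta tb mul1r /mx_eval mevalD.
  + by rewrite a0 b0 mul1r /mx_eval mevalD.
  + by rewrite a1 b1 mul1r tangentD.
- move=> c p [a [ea ta a0 a1]]; exists (fun l => c * a l); split=> [|t||].
  + exact: exp_poly_scale.
  + by rewrite (egf_scale _ _ (exp_poly_subgeom ea)) ta /mx_eval mevalZ.
  + by rewrite a0 /mx_eval mevalZ.
  + by rewrite a1 tangentZ.
- move=> p q [a [ea ta a0 a1]] [b [eb tb b0 b1]].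
  have ba := exp_poly_subgeom ea; have bb := exp_poly_subgeom eb.
  exists (bconv a b); split=> [|t||].
  + exact: exp_poly_bconv.
  + by rewrite (egf_bconv _ ba bb) ta tb /mx_eval mevalM.
  + by rewrite bconv_at0 a0 b0 /mx_eval mevalM.
  + by rewrite bconvS !bconv_at0 /shift_seq a0 a1 b0 b1 tangentM.
Qed.

Lemma lie_algebra_jet_vf_mx : not_weakly_resonant v ->
  lie_algebra (@jet_closure n C (cyclic_diff (Exp X)) k) (jet_vf_mx k X).
Proof.
move=> nwr p hp.
pose G : set C := [set x | exists m : 'I_n -> int, x = \sum_(j < n) v j *~ m j].
have [a [ea ta _ a1]] : exists a, [/\ exp_poly G a,
    forall t, egf t a = mx_eval p (jet_mx k (flow_map t)),
    a 0 = mx_eval p 1%:M & a 1 = tangent (jet_vf_mx k X) p].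
  apply: mx_eval_flow.
  - by exists (fun=> 0); rewrite big1.
  - move=> i; exists (fun j => (j == i)%:R); rewrite (bigD1 i) //= eqxx mulr1z.
    by rewrite big1 ?addr0 // => j /negbTE ->; rewrite mulr0z.
  - move=> x y [m ->] [m' ->]; exists (fun j => m j + m' j).
    by rewrite -big_split /=; apply: eq_bigr => j _; rewrite mulrzDr.
have [L [GL La]] := ea.
suff a0 : a = fun=> 0 by rewrite -/(tangent _ _) -a1 a0.
apply: (@exp_poly_eq0 _ L a _ (exp_poly_subgeom ea) La) => [x y|j].
  move=> /GL [m mE] /GL [m' mE'] exy.
  have : cexp (x - y) = 1.
    by apply: (mulIf (cexp_neq0 y)); rewrite -cexpD subrK mul1r.
  move=> /cexp_eq1 [z zE]; apply/eqP; rewrite -subr_eq0 zE.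
  have [->|z0] := eqVneq z 0; first by rewrite mulr0.
  case: nwr; exists (fun j => m j - m' j), z%:~R; split;
    first by rewrite intr_eq0.
  rewrite ratr_int -zE mE mE' -sumrB; apply: eq_bigr => j _.
  by rewrite mulrzBr.
(* At natural times the flow lies in the cyclic group, where p vanishes. *)
rewrite ta; apply: hp; apply: zariski_closure_sub.
  by exists (flow_map j%:R) => //; exact: (flow_map_cyclic X0 hv).
exact: jet_mx_flow_unit.
Qed.

End JetFlow.

(** * Characters of a triangular group *)

Lemma trig_mx_expr (K : fieldType) (n : nat) (T : 'M[K]_n) (l : nat) :
  is_trig_mx T -> is_trig_mx (T ^+ l) /\ forall j, (T ^+ l) j j = T j j ^+ l.
Proof.
move=> /is_trig_mxP tT; elim: l => [|l [/is_trig_mxP tl dl]].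
  rewrite expr0; split=> [|j]; last by rewrite expr0 mxE eqxx.
  apply/is_trig_mxP => i j ij; rewrite mxE; case: eqP => // e.
  by move: ij; rewrite e ltnn.
rewrite exprS -mulmxE; split=> [|j].
  apply/is_trig_mxP => i j ij; rewrite mxE big1 // => k _.
  have [ik|ki] := ltnP i k; first by rewrite tT ?mul0r.
  by rewrite tl ?mulr0 // (leq_ltn_trans ki).
rewrite mxE (bigD1 j) //= dl exprS big1 ?addr0 // => k kj.
have [jk|kj'] := ltnP j k; first by rewrite tT ?mul0r.
by rewrite tl ?mulr0 // ltn_neqAle kj' andbT.
Qed.

Lemma char_poly_conj (K : fieldType) (n : nat) (P A : 'M[K]_n) :
  P \in unitmx -> char_poly (P *m A *m invmx P) = char_poly A.
Proof.
move=> uP; rewrite /char_poly.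
have -> : char_poly_mx (P *m A *m invmx P) =
    map_mx polyC P *m char_poly_mx A *m map_mx polyC (invmx P).
  rewrite /char_poly_mx mulmxBr mulmxBl -!map_mxM; congr (_ - _).
  rewrite scalar_mxC -mulmxA -map_mxM mulmxV //.
  by rewrite map_mx1 mulmx1.
rewrite !det_mulmx mulrAC -det_mulmx -map_mxM mulmxV //.
by rewrite map_mx1 det1 mul1r.
Qed.

(** An identity between characters with integer exponents becomes polynomial once the negative
    exponents are moved to the other side. *)
Definition int_pos (z : int) : nat := if z is Posz k then k else 0.
Definition int_neg (z : int) : nat := if z is Negz k then k.+1 else 0.

Lemma int_posB (V : zmodType) (x : V) (z : int) :
  x *+ int_pos z - x *+ int_neg z = x *~ z.
Proof. by case: z => k /=; rewrite ?subr0 // sub0r NegzE mulrNz. Qed.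

Section Characters.
Variables (N : nat) (K : fieldType) (B : 'M[K]_N).
Implicit Types (p q : mpoly (N * N) K).

(** Where all factors take the value 1, the derivative of a product is its logarithmic derivative,
    which is additive. *)
Lemma tangent_prod_unit (I : finType) (l : I -> mpoly (N * N) K) (e : I ->
  nat) :
  (forall i, mx_eval (l i) 1%:M = 1) ->
  mx_eval (\prod_i l i ^+ e i) 1%:M = 1 /\
  tangent B (\prod_i l i ^+ e i) = \sum_i tangent B (l i) *+ e i.
Proof.
move=> l1.
have h1 : mx_eval (1 : mpoly (N * N) K) (1%:M : 'M[K]_N) = 1.
  by rewrite /mx_eval meval1.
have hM p q : mx_eval p 1%:M = 1 -> mx_eval q 1%:M = 1 ->
  mx_eval (p * q) 1%:M = 1 /\ tangent B (p * q) = tangent B p + tangent B q.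
  by move=> p1 q1; rewrite tangentM p1 q1 mulr1 mul1r {1}/mx_eval mevalM
    -!/(mx_eval _ _) p1 q1 mulr1.
elim/big_ind2: _ => [|p x q y [p1 px] [q1 qy]|i _].
- by split; rewrite ?tangent1.
- by have [pq1 pqt] := hM _ _ p1 q1; split; rewrite // pqt px qy.
elim: (e i) => [|k [k1 kt]]; first by rewrite expr0 tangent1.
by have [pq1 pqt] := hM _ _ (l1 i) k1; rewrite exprS; split;
  rewrite // pqt kt mulrS.
Qed.

Lemma mx_evalDZ c p q A : mx_eval (p + c *: q) A = mx_eval p A + c * mx_eval q
  A.
Proof. by rewrite /mx_eval mevalD mevalZ. Qed.

Lemma mx_eval_prod (I : finType) (l : I -> mpoly (N * N) K) (e : I -> nat) A :
  mx_eval (\prod_i l i ^+ e i) A = \prod_i mx_eval (l i) A ^+ e i.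
Proof.
rewrite /mx_eval rmorph_prod; apply: eq_bigr => i _; exact: rmorphXn.
Qed.

(** The polynomial A |-> u A' w, with A' the submatrix of A selected by i. For u a row of P and w a
    column of its inverse, this is an entry of the conjugate of A' by P. *)
Definition mx_linear_form (n : nat) (i : 'I_n ->
  'I_N) (u : 'rV[K]_n) (w : 'cV[K]_n) :
  mpoly (N * N) K :=
  \sum_a \sum_b (u 0 a * w b 0) *: mpolyX K (mnm1 (mxvec_index (i a) (i b))).

Lemma mx_eval_linear_form n (i : 'I_n -> 'I_N) u w A :
  mx_eval (mx_linear_form i u w) A =
  (u *m (\matrix_(a, b) A (i a) (i b)) *m w) 0 0.
Proof.
have es (I : Type) (r : seq I) (F : I -> mpoly (N * N) K) :
  mx_eval (\sum_(j <- r) F j) A = \sum_(j <- r) mx_eval (F j) A.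
  elim: r => [|j r IH]; first by rewrite !big_nil /mx_eval meval0.
  by rewrite !big_cons /mx_eval mevalD -IH.
rewrite es -mulmxA mxE; apply: eq_bigr => a _.
rewrite es mxE mulr_sumr; apply: eq_bigr => b _.
by rewrite /mx_eval mevalZ -/(mx_eval _ _) mx_evalX !mxE -mulrA [w _ _ *
  _]mulrC.
Qed.

Lemma tangent_linear_form n (i : 'I_n -> 'I_N) u w :
  tangent B (mx_linear_form i u w) =
  (u *m (\matrix_(a, b) B (i a) (i b)) *m w) 0 0.
Proof.
have ts (I : Type) (r : seq I) (F : I -> mpoly (N * N) K) :
  tangent B (\sum_(j <- r) F j) = \sum_(j <- r) tangent B (F j).
  by elim: r => [|j r IH]; rewrite ?big_nil ?tangent0 // !big_cons tangentD IH.
rewrite ts -mulmxA mxE; apply: eq_bigr => a _.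
rewrite ts mxE mulr_sumr; apply: eq_bigr => b _.
by rewrite tangentZ tangentX !mxE -mulrA [w _ _ * _]mulrC.
Qed.

End Characters.

(** * A weak resonance excludes X from the Lie algebra *)

Section Resonance.
Variables (R : realType) (n : nat).
Local Notation C := (Cplx R).
Variable X : 'I_n -> fps n C.
Hypothesis X0 : singular_vf X.
Variable v : 'I_n -> C.
Hypothesis hv : has_spectrum (linear_part X) v.

Lemma jet1_index : exists i : 'I_n -> 'I_#|jet_monom n 1|,
  forall a, jet_exponent (i a) = mnm1 a.
Proof.
have h (a : 'I_n) : (mdeg (mnm1 a) < 2)%N by rewrite mdeg1.
have m_in a : BMultinom (h a) \in jet_monom n 1 by rewrite unfold_in /jet_monom
  /= mdeg1.
exists (fun a => enum_rank_in (m_in a) (BMultinom (h a))) => a.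
by rewrite /jet_exponent enum_rankK_in.
Qed.

(** Schur's theorem gives the triangular form. Its diagonal and v are the roots of the same
    characteristic polynomial, hence agree up to a permutation. *)
Lemma triangular_linear_part : (0 < n)%N -> exists P : 'M[C]_n,
  [/\ P \in unitmx, is_trig_mx (P *m linear_part X *m invmx P) &
   exists s : {perm 'I_n},
     forall j, (P *m linear_part X *m invmx P) j j = v (s j)].
Proof.
move=> n_gt0; have [P uP tP] := Schur (linear_part X) n_gt0.
have {}uP := unitarymx_unit uP; exists P.
have {}tP : is_trig_mx (P *m linear_part X *m invmx P).
  exact: (eq_ind _ (fun A => is_true (is_trig_mx A)) tP _ (conjumx _ uP)).
split=> //; move: tP; set T := P *m _ *m _ => tP.
pose tv := [tuple v i | i < n]; pose tT := [tuple T i i | i < n].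
have : \prod_(x <- tT) ('X - x%:P) = \prod_(x <- tv) ('X - x%:P).
  rewrite !big_tuple; transitivity (char_poly (linear_part X)).
    rewrite -(char_poly_conj _ uP) -/T char_poly_trig //.
    by apply: eq_bigr => i _; rewrite tnth_mktuple.
  by rewrite hv; apply: eq_bigr => i _; rewrite tnth_mktuple.
move=> /prod_XsubC_eq /tuple_permP [s /val_inj sE]; exists s => j.
by have := congr1 (fun t => tnth t j) sE; rewrite !tnth_mktuple => ->.
Qed.

(** The diagonal entries of the l-th power of a triangular matrix are l-th powers; summing the
    exponential series entrywise gives the exponential of the diagonal entry. *)
Lemma linear_part_flow_conj (P : 'M[C]_n) t j : P \in unitmx ->
  is_trig_mx (P *m linear_part X *m invmx P) ->
  (P *m linear_part (flow_map X t) *m invmx P) j j =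
  cexp (t * (P *m linear_part X *m invmx P) j j).
Proof.
move=> uP tP; set T := P *m _ *m _ in tP *.
have TX l : T ^+ l = P *m (linear_part X) ^+ l *m invmx P.
  elim: l => [|l IH]; first by rewrite !expr0 mulmx1 mulmxV.
  by rewrite !exprSr IH -!mulmxE !mulmxA mulmxKV.
have bX a b : subgeom (fun l => ((linear_part X) ^+ l) a b).
  have := subgeom_orbit X0 hv (fps_var C a) (mnm1 b);
    rewrite (orbit_at1 X0) lin_coef_var.
  by congr subgeom; apply/funext => l; rewrite -rowE mxE.
rewrite -egf_pow.
rewrite (_ : (fun l => _) = fun l => \sum_b \sum_a
    P j a * invmx P b j * ((linear_part X) ^+ l) a b); last first.
  apply/funext => l; rewrite -(trig_mx_expr l tP).2 TX mxE.
  apply: eq_bigr => b _; rewrite mxE mulr_suml; apply: eq_bigr => a _.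
  by rewrite mulrAC.
rewrite egf_sum => [|b _]; last by apply: subgeom_sum => a _;
  apply: subgeom_scale.
rewrite mxE; apply: eq_bigr => b _; rewrite mxE mulr_suml.
rewrite egf_sum => [|a _]; last by apply: subgeom_scale.
apply: eq_bigr => a _; rewrite (egf_scale _ _ (bX a b)).
by rewrite (linear_part_flow X0) mulrAC.
Qed.

Lemma not_weakly_resonant_lie :
  lie_algebra (@jet_closure n C (cyclic_diff (Exp X)) 1) (jet_vf_mx 1 X) ->
  not_weakly_resonant v.
Proof.
move=> lie [m [q [q0 mq]]].
have [n0|n_gt0] := posnP n.
  move: mq; rewrite big1 => [|[j jn] _]; last first.
    by exfalso; move: (leq_trans jn (eq_leq n0)).
  move/esym/eqP; rewrite mulf_eq0 fmorph_eq0 (negbTE q0) orbF two_pi_iE.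
  by move/eqP => [/eqP]; rewrite mulf_eq0 pnatr_eq0 /= gt_eqF // pi_gt0.
have [P [uP tP [s Ps]]] := triangular_linear_part n_gt0.
have [i iE] := jet1_index.
(* Multiplying by the denominator of q turns the right-hand side into 2 pi i times [numq q]; s
   matches m with the triangular form. *)
pose e j : int := m (s j) * denq q.
pose lam j := v (s j).
have lam_sum : \sum_j lam j *~ e j = two_pi_i R * (numq q)%:~R.
  transitivity ((\sum_j v j *~ m j) *~ denq q).
    rewrite [in RHS](reindex_inj (@perm_inj _ s)) /= mulrz_suml.
    by apply: eq_bigr => j _; rewrite /e mulrzA.
  rewrite mq -mulrzr -mulrA; congr (_ * _).
  rewrite -(ratr_int C) -(ratr_int C) -rmorphM /=; congr ratr.
  by rewrite -{1}(divq_num_den q) divfK // intr_eq0 denq_neq0.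
pose l j := mx_linear_form i (row j P) (col j (invmx P)).
have entry (A : 'M[C]_n) j : (row j P *m A *m col j (invmx P)) 0 0 =
  (P *m A *m invmx P) j j.
  by rewrite -row_mul colE mulmxA -row_mul -colE 2![LHS]mxE.
have i_inj : injective i.
  move=> a b /(congr1 (@jet_exponent n 1)); rewrite !iE => ab.
  have := congr1 (fun c : multinom n => c a) ab; rewrite !mnm1E eqxx.
  by case: eqP.
have l1 j : mx_eval (l j) 1%:M = 1.
  rewrite mx_eval_linear_form (_ : \matrix_(a, b) _ = 1%:M).
    by rewrite entry mulmx1 mulmxV // mxE eqxx.
  by apply/matrixP => a b; rewrite !mxE (inj_eq i_inj).
have lB j : tangent (jet_vf_mx 1 X) (l j) = lam j.
  rewrite tangent_linear_form (_ : \matrix_(a, b) _ = linear_part X).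
    by rewrite entry Ps.
  apply/matrixP => a b; rewrite [LHS]mxE jet_vf_mx_orbit /jet_orbit !iE.
  have := congr1 (fun f => f 1%N) (orbit_at1 X0 (fps_var C a) b).
  by rewrite lin_coef_var expr1 -rowE mxE.
have lA t j : mx_eval (l j) (jet_mx 1 (flow_map X t)) = cexp (t * lam j).
  rewrite mx_eval_linear_form.
  rewrite (_ : \matrix_(a, b) _ = linear_part (flow_map X t)).
    rewrite entry; apply: etrans (linear_part_flow_conj t j uP tP) _.
    by rewrite Ps.
  apply/matrixP => a b; rewrite [LHS]mxE (jet_mx_flow X0 hv) /jet_orbit !iE.
  by rewrite [RHS]mxE.
have cexp_prod t (f : 'I_n -> nat) :
  \prod_j cexp (t * lam j) ^+ f j = cexp (t * \sum_j lam j *+ f j).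
  elim/big_ind2: _ => [|x a y b -> ->|j _]; first by rewrite mulr0 cexp0.
    by rewrite mulrDr cexpD.
  elim: (f j) => [|k IH]; first by rewrite expr0 mulr0n mulr0 cexp0.
  by rewrite exprS IH mulrS mulrDr cexpD.
have flow_prod t (f : 'I_n -> nat) :
  mx_eval (\prod_j l j ^+ f j) (jet_mx 1 (flow_map X t)) =
  cexp (t * \sum_j lam j *+ f j).
  rewrite mx_eval_prod; apply: etrans (cexp_prod t f).
  by apply: eq_bigr => j _; rewrite (lA t j).
have e_sum : \sum_j lam j *+ int_pos (e j) - \sum_j lam j *+ int_neg (e j) =
    two_pi_i R * (numq q)%:~R.
  by rewrite -sumrB -lam_sum; apply: eq_bigr => j _; exact: int_posB.
have [pos1 post] := tangent_prod_unit (jet_vf_mx 1 X) (fun j =>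
  int_pos (e j)) l1.
have [neg1 negt] := tangent_prod_unit (jet_vf_mx 1 X) (fun j =>
  int_neg (e j)) l1.
set pos := \prod_j _ in pos1 post; set neg := \prod_j _ in neg1 negt.
(* At the integer time z the two monomials are exponentials of numbers differing by 2 pi i times z
   and [numq q]. *)
have vanish : vanishes_on (@jet_closure n C (cyclic_diff (Exp X)) 1)
    (pos + (-1) *: neg).
  apply: zariski_closure_vanishes => A [F /(cyclic_flow_map X0 hv) [z ->] <-].
  apply: etrans (mx_evalDZ _ _ _ _) _; rewrite (flow_prod z%:~R) (flow_prod
    z%:~R).
  rewrite mulN1r; apply/eqP; rewrite subr_eq0; apply/eqP.
  apply: (@cexp_periodic _ _ _ (z * numq q)).
  by rewrite -mulrBr e_sum intrM mulrCA.
(* The tangent condition would force 2 pi i times [numq q] to be 0, although q is nonzero. *)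
have := lie _ vanish; rewrite -/(tangent _ _) tangentD tangentZ post negt
  mulN1r.
have tangent_sum (f : 'I_n -> nat) :
  \sum_j tangent (jet_vf_mx 1 X) (l j) *+ f j = \sum_j lam j *+ f j.
  by apply: eq_bigr => j _; rewrite (lB j).
rewrite !tangent_sum.
rewrite e_sum => /eqP; rewrite mulf_eq0 intr_eq0 numq_eq0 (negbTE q0) orbF.
rewrite two_pi_iE => /eqP [/eqP]; rewrite mulf_eq0 pnatr_eq0 /=.
by rewrite gt_eqF // pi_gt0.
Qed.

End Resonance.

Theorem theorem4p15 (R : realType) (n : nat)
    (X : 'I_n -> fps n (Cplx R)) (hX : singular_vf X)
    (v : 'I_n -> Cplx R) (hv : has_spectrum (linear_part X) v) :
  infinitesimal_generator X (Exp X) <-> not_weakly_resonant v.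
Proof.
(* Jets of order 1 already carry the eigenvalues, and so detect a weak resonance. *)
split=> [[_ [_ /(_ 1%N isT)]]|nwr]; first exact: not_weakly_resonant_lie.
by split=> //; split=> // k _; exact: (lie_algebra_jet_vf_mx hX hv).
Qed.
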